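(* Let $n\ge1$, $1<p<\infty$ and $0<\gamma<1$. There exists a (small) number $s_0=s_0(n,p,\gamma)>0$ such that the following holds. Let $\Omega\subset\mathbb R^n$ be a domain, $T>0$, $\Omega_T=\Omega\times(0,T)$, $0<q<\infty$, $0<\rho<1$ and $0<s\le s_0$. Then there exist positive constants $c_1$ and $c_2$, depending only on $n,p,q,\gamma,\rho,s$, such that for every measurable function $f:\Omega_T\to[-\infty,\infty]$ \[ c_1\|f\|_{\mathrm{PBMO}^+_{\gamma,0,s}(\Omega_T)}\le\|f\|_{\mathrm{PBMO}^+_{\rho,q}(\Omega_T)}\le c_2\|f\|_{\mathrm{PBMO}^+_{\gamma,0,s}(\Omega_T)} , \] where these quantities are allowed to take the value $\infty$.
   Context: Points of $\mathbb R^{n+1}$ are written $(x,t)$ with $x\in\mathbb R^n$, $t\in\mathbb R$; $|E|$ is Lebesgue measure, integrals are with respect to $dx\,dt$, and $⨍_E g=\frac1{|E|}\int_E g$ denotes the integral average. Write $g_+=\max\{g,0\}$, $g_-=-\min\{g,0\}$. A domain is a nonempty open connected set. For $x\in\mathbb R^n$ and $L>0$ let $Q(x,L)=\{y\in\mathbb R^n:|y_i-x_i|\le L,\ i=1,\dots,n\}$. A parabolic rectangle (in the $p$-geometry, $1<p<\infty$ fixed) centered at $(x,t)$ with side length $L>0$ is $R=R(x,t,L)=Q(x,L)\times(t-L^p,t+L^p)$. For $-1<\gamma<1$ its upper and lower parts are $R^+(\gamma)=Q(x,L)\times(t+\gamma L^p,t+L^p)$ and $R^-(\gamma)=Q(x,L)\times(t-L^p,t-\gamma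 L^p)$. Integral-type parabolic BMO: for $0\le\rho<1$ and $0<q<\infty$, \[ \|f\|_{\mathrm{PBMO}^+_{\rho,q}(\Omega_T)}=\sup_{R\subset\Omega_T}\ \inf_{c\in\mathbb R}\Big(⨍_{R^+(\rho)}(f-c)_+^q+⨍_{R^-(\rho)}(f-c)_-^q\Big)^{1/q}. \] For $0<s\le1$, a measurable set $E\subset\mathbb R^{n+1}$ with $0<|E|<\infty$ and a measurable function $g:E\to[-\infty,\infty]$, the maximal $s$-median of $g$ over $E$ is $m_g^s(E)=\inf\{a\in\mathbb R:|\{z\in E:g(z)>a\}|<s|E|\}$ (with $\inf\emptyset=\infty$). Median-type parabolic BMO: for $0\le\gamma<1$ and $0<s\le1$, \[ \|f\|_{\mathrm{PBMO}^+_{\gamma,0,s}(\Omega_T)}=\sup_{R\subset\Omega_T}\ \inf_{c\in\mathbb R}\Big(m^s_{(f-c)_+}(R^+(\gamma))+m^s_{(f-c)_-}(R^-(\gamma))\Big). \] Both suprema are over all parabolic rectangles $R\subset\Omega_T$. (The subscript $0$ is only part of the notation for the median-type space.) *)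

(* Defs.v *)
From HB Require Import structures.
From mathcomp Require Import all_boot all_order all_algebra.
From mathcomp Require Import all_classical all_reals all_analysis.
From mathcomp Require Import measurable_realfun.

Set Implicit Arguments.
Unset Strict Implicit.
Unset Printing Implicit Defensive.

Import Order.TTheory GRing.Theory Num.Theory.
Import numFieldNormedType.Exports.

Local Open Scope classical_set_scope.
Local Open Scope ring_scope.

(* The Borel sigma-algebra of R^n, generated by the coordinate projections. *)
Section measurable_rV.
Context {R : realType}.
Variable n : nat.

Let coord : 'I_n -> 'rV[R]_n -> measurableTypeR R := fun i x => x ord0 i.

Let rV_set0 : g_sigma_preimage coord set0.
Proof. exact: sigma_algebra0. Qed.

Let rV_setC A : g_sigma_preimage coord A -> g_sigma_preimage coord (~` A).
Proof. exact: sigma_algebraC. Qed.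

Let rV_bigcup (F : _^nat) : (forall i, g_sigma_preimage coord (F i)) ->
  g_sigma_preimage coord (\bigcup_i (F i)).
Proof. exact: sigma_algebra_bigcup. Qed.

HB.instance Definition _ := @isMeasurable.Build default_measure_display
  'rV[R]_n (g_sigma_preimage coord) rV_set0 rV_setC rV_bigcup.

Lemma measurable_rV_coord (i : 'I_n) :
  measurable_fun [set: 'rV[R]_n] (fun x => x ord0 i : measurableTypeR R).
Proof.
move=> _ Y mY; rewrite setTI; apply: sub_sigma_algebra => /=.
rewrite -bigcup_seq/=; exists i => /=; first by rewrite mem_index_enum.
by exists Y => //; rewrite setTI.
Qed.

Lemma measurable_fun_rV d (T : measurableType d) (f : T -> 'rV[R]_n) :
  (forall i, measurable_fun [set: T] (fun z => f z ord0 i : measurableTypeR R)) ->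
  measurable_fun [set: T] f.
Proof.
move=> mf; have h : g_sigma_preimage coord `<=`
    [set A | measurable (f @^-1` A)].
  apply: smallest_sub => /=.
    split => /=.
    - by rewrite preimage_set0.
    - by move=> A mA; rewrite setTD preimage_setC; exact: measurableC.
    - by move=> F mF; rewrite preimage_bigcup; exact: bigcupT_measurable.
  move=> A; rewrite -bigcup_seq => -[/= i _ [B mB <-]] /=.
  by rewrite setTI -[X in measurable X]setTI; exact: (mf i).
by move=> _ A mA; rewrite setTI; exact: h.
Qed.

End measurable_rV.

Section lebesgue_rV_step.
Context {R : realType}.
Variable n : nat.
Local Notation mR := (measurableTypeR R).

Definition rV_cons (z : mR * 'rV[R]_n) : 'rV[R]_n.+1 :=
  row_mx (z.1)%:M z.2 : 'rV[R]_(1 + n).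

Definition rV_uncons (v : 'rV[R]_n.+1) : mR * 'rV[R]_n :=
  (v ord0 ord0, \row_i v ord0 (lift ord0 i)).

Lemma rV_cons0 z : rV_cons z ord0 ord0 = z.1.
Proof.
have -> : (ord0 : 'I_n.+1) = lshift n (ord0 : 'I_1) by exact/val_inj.
by rewrite [LHS]row_mxEl mxE eqxx.
Qed.

Lemma rV_consS z i : rV_cons z ord0 (lift ord0 i) = z.2 ord0 i.
Proof.
have -> : lift ord0 i = rshift 1 i by exact/val_inj.
by rewrite [LHS]row_mxEr.
Qed.

Lemma rV_consK : cancel rV_cons rV_uncons.
Proof.
move=> [a v]; rewrite /rV_uncons rV_cons0; congr pair.
by apply/rowP => i; rewrite mxE rV_consS.
Qed.

Lemma rV_unconsK : cancel rV_uncons rV_cons.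
Proof.
move=> v; apply/rowP => i; case: (unliftP ord0 i) => [j|] ->.
  by rewrite rV_consS mxE.
by rewrite rV_cons0.
Qed.

Lemma measurable_rV_cons : measurable_fun [set: mR * 'rV[R]_n] rV_cons.
Proof.
apply: measurable_fun_rV => i; case: (unliftP ord0 i) => [j|] ->.
  under eq_fun do rewrite rV_consS.
  exact: (measurableT_comp (measurable_rV_coord j) measurable_snd).
under eq_fun do rewrite rV_cons0.
exact: measurable_fst.
Qed.

Lemma measurable_rV_uncons : measurable_fun [set: 'rV[R]_n.+1] rV_uncons.
Proof.
apply: measurable_fun_pair; first exact: measurable_rV_coord.
apply: measurable_fun_rV => i; under eq_fun do rewrite mxE.
exact: measurable_rV_coord.
Qed.

Variable mu : {sigma_finite_measure set 'rV[R]_n -> \bar R}.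

Definition lebesgue_rV_step : set 'rV[R]_n.+1 -> \bar R :=
  pushforward (@lebesgue_measure R \x mu)%E rV_cons.

Let mpre (A : set 'rV[R]_n.+1) : measurable A -> measurable (rV_cons @^-1` A).
Proof. by move=> mA; rewrite -[X in measurable X]setTI; exact: measurable_rV_cons. Qed.

Let step0 : lebesgue_rV_step set0 = 0%E.
Proof. by rewrite /lebesgue_rV_step /pushforward preimage_set0 measure0. Qed.

Let step_ge0 A : (0 <= lebesgue_rV_step A)%E.
Proof. by apply: (measure_ge0 (@lebesgue_measure R \x mu)%E). Qed.

Let step_sigma_additive : semi_sigma_additive lebesgue_rV_step.
Proof.
move=> F mF tF mUF; rewrite /lebesgue_rV_step /pushforward preimage_bigcup.
apply: measure_semi_sigma_additive.
- by move=> k; exact: mpre.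
- apply/trivIsetP => /= i j _ _ ij; rewrite -preimage_setI.
  by move/trivIsetP : tF => /(_ _ _ _ _ ij) ->//; rewrite preimage_set0.
- by rewrite -preimage_bigcup; exact: mpre.
Qed.

HB.instance Definition _ := isMeasure.Build _ _ _ lebesgue_rV_step
  step0 step_ge0 step_sigma_additive.

Let step_sigma_finite : sigma_finite setT lebesgue_rV_step.
Proof.
have /sigma_finiteP[F [TF ndF Foo]] := sigma_finiteT (@lebesgue_measure R).
have /sigma_finiteP[G [TG ndG Goo]] := sigma_finiteT mu.
exists (fun k => rV_uncons @^-1` (F k `*` G k)).
  apply/esym/seteqP; split => // v _.
  have [n1 _ Fn1] : (\bigcup_k F k) (rV_uncons v).1 by rewrite -TF.
  have [n2 _ Gn2] : (\bigcup_k G k) (rV_uncons v).2 by rewrite -TG.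
  exists (maxn n1 n2) => //; split.
    by move: Fn1; exact/subsetPset/ndF/leq_maxl.
  by move: Gn2; exact/subsetPset/ndG/leq_maxr.
move=> k; have [mF Fk] := Foo k; have [mG Gk] := Goo k; split.
  rewrite -[X in measurable X]setTI; apply: measurable_rV_uncons => //.
  exact: measurableX.
rewrite /lebesgue_rV_step /pushforward -comp_preimage.
rewrite (_ : rV_uncons \o rV_cons = id); last first.
  by apply/funext => z /=; exact: rV_consK.
by rewrite preimage_id product_measure1E// lte_mul_pinfty// ge0_fin_numE.
Qed.

HB.instance Definition _ := @Measure_isSigmaFinite.Build _ _ _
  lebesgue_rV_step step_sigma_finite.

End lebesgue_rV_step.

Section lebesgue_rV.
Context {R : realType}.

Fixpoint lebesgue_rV n : {sigma_finite_measure set 'rV[R]_n -> \bar R} :=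
  match n with
  | 0 => \d_(0 : 'rV[R]_0)
  | n'.+1 => lebesgue_rV_step (lebesgue_rV n')
  end.

Lemma lebesgue_rV_box n (A : 'I_n -> set (measurableTypeR R)) :
  (forall i, measurable (A i)) ->
  (lebesgue_rV n [set x | forall i, A i (x ord0 i)] =
   \prod_(i < n) lebesgue_measure (A i))%E.
Proof.
elim: n A => [|n IH] A mA.
  by rewrite big_ord0 /= diracE mem_set//= => -[].
rewrite big_ord_recl/= /lebesgue_rV_step /pushforward.
rewrite (_ : _ @^-1` _ = A ord0 `*`
    [set x : 'rV[R]_n | forall i, A (lift ord0 i) (x ord0 i)]).
  rewrite product_measure1E//; first by rewrite (IH (fun i => A (lift ord0 i))).
  rewrite (_ : [set _ | _] = \big[setI/setT]_(i < n)
     ((fun x : 'rV[R]_n => x ord0 i : measurableTypeR R) @^-1` A (lift ord0 i))).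
    apply: bigsetI_measurable => i _; rewrite -[X in measurable X]setTI.
    exact: measurable_rV_coord.
  by rewrite -bigcap_seq; apply/seteqP; split => x /= H i;
    [move=> _; exact: H|apply: H => /=; rewrite mem_index_enum].
apply/seteqP; split=> z /=.
  move=> H; split; first by have := H ord0; rewrite rV_cons0.
  by move=> i; have := H (lift ord0 i); rewrite rV_consS.
move=> [H0 H] i; case: (unliftP ord0 i) => [j|] ->.
  by rewrite rV_consS.
by rewrite rV_cons0.
Qed.

End lebesgue_rV.

Definition borel_lebesgue (R : realType) (n : nat) :
    {measure set ('rV[R]_n * measurableTypeR R)%type -> \bar R} :=
  (lebesgue_rV n \x @lebesgue_measure R)%E.

(* Points (x, t) of R^{n+1}, with the sigma-algebra of all Lebesgue measurable
   sets (not just the Borel ones) and the complete Lebesgue measure on it. *)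
Definition spacetime (R : realType) (n : nat) :=
  caratheodory_type (mu_ext (borel_lebesgue R n)).

HB.instance Definition _ (R : realType) (n : nat) :=
  Measurable.on (spacetime R n).

Definition lebesgue_st {R : realType} {n : nat} :
    set (spacetime R n) -> \bar R :=
  @completed_measure_extension _ _ _ (borel_lebesgue R n).

HB.instance Definition _ (R : realType) (n : nat) :=
  Measure.on (@lebesgue_st R n).

Definition is_domain (T : topologicalType) (A : set T) : Prop :=
  [/\ A !=set0, open A & connected A].

Section parabolic.
Context {R : realType} {n : nat}.
Implicit Types (x : 'rV[R]_n) (t L p gamma rho q s : R).
Implicit Types (E Q : set (spacetime R n)) (g f : spacetime R n -> \bar R).

Definition cylinder (Omega : set 'rV[R]_n) (T : R) : set (spacetime R n) :=
  Omega `*` `]0, T[.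

Definition cube x L : set 'rV[R]_n :=
  [set y : 'rV[R]_n | forall i, `|y ord0 i - x ord0 i| <= L].

Definition prect p x t L : set (spacetime R n) :=
  cube x L `*` `]t - L `^ p, t + L `^ p[.

Definition prect_up p gamma x t L : set (spacetime R n) :=
  cube x L `*` `]t + gamma * L `^ p, t + L `^ p[.

Definition prect_lo p gamma x t L : set (spacetime R n) :=
  cube x L `*` `]t - L `^ p, t - gamma * L `^ p[.

Local Open Scope ereal_scope.

(* Only meaningful when E has positive finite measure. *)
Definition average E g : \bar R :=
  ((fine (lebesgue_st E))^-1)%:E * \int[lebesgue_st]_(z in E) g z.

Definition max_median s g E : \bar R :=
  ereal_inf [set a%:E | a in
    [set a : R | lebesgue_st [set z | E z /\ a%:E < g z] < s%:E * lebesgue_st E]].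

Definition PBMO p rho q Q f : \bar R :=
  ereal_sup [set e | exists x t L, [/\ (0 < L)%R, prect p x t L `<=` Q &
    e = ereal_inf (range (fun c : R =>
      (average (prect_up p rho x t L)
         (fun z => ((fun w => f w - c%:E)^\+ z) `^ q) +
       average (prect_lo p rho x t L)
         (fun z => ((fun w => f w - c%:E)^\- z) `^ q)) `^ q^-1))]].

Definition PBMO_median p gamma s Q f : \bar R :=
  ereal_sup [set e | exists x t L, [/\ (0 < L)%R, prect p x t L `<=` Q &
    e = ereal_inf (range (fun c : R =>
      max_median s (fun w => f w - c%:E)^\+ (prect_up p gamma x t L) +
      max_median s (fun w => f w - c%:E)^\- (prect_lo p gamma x t L)))]].

End parabolic.

(* Main.v *)
(* Time reversal [(x, t) |-> (x, -t)], [f |-> - f] exchanges the upper and lower parts,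
   so it is enough to bound [f] from above on upper parts.  Suppose every rectangle
   has a constant [c] with [f <= c + B] on most of its upper part and [f >= c - B] on
   most of its lower part.  If the upper part of [R1] overlaps enough with the lower
   part of [R2], some point sees both constants and [c_R2 <= c_R1 + 2 B].

   Decay: subdivide the top of a rectangle [R] into nested grid cells, attach to each
   cell a rectangle whose top contains it, and stop at the first cells whose constant
   exceeds [c_R + 2 B].  By linking with the parent, that constant is at most
   [c_R + 4 B].  The lower part of the rectangle of a stopped cell contains a cell of
   the same column on most of which [f > c_R + B]; such lowered cells are nested or
   disjoint, the maximal ones control the stopped cells through a column above them, and
   so the stopped set has measure at most half that of the top once [s] is small.
   Outside of it [f <= c_R + 3 B] almost everywhere by a density argument.  Iterating
   gives exponential decay of the superlevel sets of [f - c_R] at the top of [R].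

   Change of lag: the upper part of [R], for any lag, is covered by tops of rectangles
   of size [L / N], each joined by a straight chain of links to the rectangle of size
   [L / N] concentric with [R].  The chain has about [N ^ p] steps in time but needs
   only [N] in space, which is possible for [N] large because [p > 1]. *)

Require Import Defs.
From mathcomp Require Import all_boot all_order all_algebra.
From mathcomp Require Import all_classical all_reals all_analysis.
From mathcomp Require Import measurable_realfun.
From mathcomp Require Import ring lra.
Import Order.TTheory GRing.Theory Num.Theory.
Import numFieldNormedType.Exports.
Local Open Scope classical_set_scope.
Local Open Scope ring_scope.

Set Implicit Arguments.
Unset Strict Implicit.
Unset Printing Implicit Defensive.

(** * Boxes and outer regularity in space-time *)

Section coordinates.
Context {R : realType} {X : Type} {n : nat}.
Variables (xs : X -> 'I_n -> R) (tm : X -> R).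

(** A flag [true] puts the bound just before its point: it closes a lower end and opens an upper
    end. Thus [true false] is closed, [true true] is closed on the left only, and [false true] is
    open. *)
Definition cbox (ca cb : bool) (a b : 'I_n -> R) (cu cv : bool) (u v : R) : set X :=
  [set z | (forall i, xs z i \in Interval (BSide ca (a i)) (BSide cb (b i))) /\
           tm z \in Interval (BSide cu u) (BSide cv v)].

Definition coord_halfspaces : set (set X) :=
  [set A | (exists i y, A = [set z | xs z i < y]) \/
           (exists y, A = [set z | tm z < y])].

End coordinates.

Section spacetime_coordinates.
Context {R : realType} {n : nat}.

Definition space_coord (z : spacetime R n) (i : 'I_n) : R := z.1 ord0 i.

(** The decay argument is written for abstract coordinates; with [b = false] time runs backwards, so
    that the same argument for [- f] bounds [f] from below. *)
Definition time_coord (b : bool) (z : spacetime R n) : R :=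
  if b then z.2 else - z.2.

Lemma borel_measurable_spacetime (A : set ('rV[R]_n * measurableTypeR R)) :
  measurable A -> measurable (A : set (spacetime R n)).
Proof. exact: caratheodory_measurable_mu_ext. Qed.

Lemma lebesgue_st_borel (A : set ('rV[R]_n * measurableTypeR R)) :
  measurable A -> lebesgue_st (A : set (spacetime R n)) = borel_lebesgue R n A.
Proof. exact: measurable_mu_extE. Qed.

Lemma lebesgue_itv_bnd (cu cv : bool) (u v : R) : u <= v ->
  lebesgue_measure [set` Interval (BSide cu u) (BSide cv v)] = (v - u)%:E.
Proof.
move=> uv; rewrite lebesgue_measure_itv/= lte_fin.
case: ltP => // vu.
by have -> : u = v by [apply/eqP; rewrite eq_le uv vu]; rewrite subrr.
Qed.

Lemma measurable_rV_box (A : 'I_n -> set (measurableTypeR R)) :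
  (forall i, measurable (A i)) ->
  measurable [set x : 'rV[R]_n | forall i, A i (x ord0 i)].
Proof.
move=> mA.
rewrite (_ : [set _ | _] = \big[setI/setT]_(i < n)
  ((fun x : 'rV[R]_n => x ord0 i : measurableTypeR R) @^-1` A i)).
  apply: bigsetI_measurable => i _; rewrite -[X in measurable X]setTI.
  exact: measurable_rV_coord.
by rewrite -bigcap_seq; apply/seteqP; split => x /= H i;
  [move=> _; exact: H|apply: H => /=; rewrite mem_index_enum].
Qed.

Lemma cbox_spacetimeE (b : bool) ca cb (x y : 'I_n -> R) cu cv u v :
  exists cu' cv' u' v', v' - u' = v - u /\
  cbox space_coord (time_coord b) ca cb x y cu cv u v =
  ([set w : 'rV[R]_n | forall i,
      [set` Interval (BSide ca (x i)) (BSide cb (y i))] (w ord0 i)]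
   `*` ([set` Interval (BSide cu' u') (BSide cv' v')] : set (measurableTypeR R))
   : set (spacetime R n)).
Proof.
case: b; first by exists cu, cv, u, v.
exists (~~ cv), (~~ cu), (- v), (- u); split; first by ring.
apply/seteqP; split => z [zx zt]; split => //; move: zt.
  by rewrite /cbox/= !in_itv/= => /andP[]; case: cu; case: cv => /= ? ?;
    apply/andP; split; lra.
by rewrite /cbox/= !in_itv/= => /andP[]; case: cu; case: cv => /= ? ?;
    apply/andP; split; lra.
Qed.

Lemma measurable_spacetime_cbox b ca cb (x y : 'I_n -> R) cu cv u v :
  measurable (cbox space_coord (time_coord b) ca cb x y cu cv u v).
Proof.
have [cu' [cv' [u' [v' [_ ->]]]]] := cbox_spacetimeE b ca cb x y cu cv u v.
apply: borel_measurable_spacetime; apply: measurableX => //.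
exact: (measurable_rV_box (A := fun i => [set` Interval (BSide ca (x i)) (BSide cb (y i))])).
Qed.

Lemma lebesgue_st_cbox b ca cb (x y : 'I_n -> R) cu cv u v :
  (forall i, x i <= y i) -> u <= v ->
  lebesgue_st (cbox space_coord (time_coord b) ca cb x y cu cv u v) =
  (\prod_(i < n) (y i - x i) * (v - u))%:E.
Proof.
move=> xy uv.
have [cu' [cv' [u' [v' [uv' ->]]]]] := cbox_spacetimeE b ca cb x y cu cv u v.
rewrite lebesgue_st_borel; last first.
  apply: measurableX => //.
  exact: (measurable_rV_box (A := fun i => [set` Interval (BSide ca (x i)) (BSide cb (y i))])).
rewrite [LHS]product_measure1E//; last first.
  exact: (measurable_rV_box (A := fun i => [set` Interval (BSide ca (x i)) (BSide cb (y i))])).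
transitivity ((\prod_(i < n) (y i - x i))%:E * (v - u)%:E)%E; last by rewrite EFinM.
congr (_ * _)%E.
  apply: (etrans (lebesgue_rV_box (A := fun i => [set` Interval (BSide ca (x i)) (BSide cb (y i))]) _)).
    by move=> i.
  by rewrite -prodEFin; apply: eq_bigr => i _; exact: lebesgue_itv_bnd.
by rewrite -uv'; apply: lebesgue_itv_bnd; rewrite -subr_ge0 uv' subr_ge0.
Qed.

(** It is enough that the identity is measurable from the sigma-algebra generated by the
    half-spaces, hence that each coordinate is, which is tested on open half-lines. *)
Lemma borel_coord_halfspaces b (A : set ('rV[R]_n * measurableTypeR R)) :
  measurable A -> <<s coord_halfspaces space_coord (time_coord b) >> A.
Proof.
move=> mA.
pose Y := g_sigma_algebraType (coord_halfspaces space_coord (time_coord b)).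
suff mid : measurable_fun [set: Y] (fun z : Y => (z : 'rV[R]_n * measurableTypeR R)).
  by have := mid measurableT A mA; rewrite setTI.
have mt : measurable_fun [set: Y] (fun z : Y => time_coord b z : measurableTypeR R).
  apply: (measurability _ (RGenInftyO.measurableE R)) => _ [_ [y ->] <-].
  rewrite setTI; apply: sub_sigma_algebra; right; exists y.
  by apply/seteqP; split => z /=; rewrite in_itv/=.
apply/measurable_fun_pairP; split => /=.
  apply: measurable_fun_rV => i.
  apply: (measurability _ (RGenInftyO.measurableE R)) => _ [_ [y ->] <-].
  rewrite setTI; apply: sub_sigma_algebra; left; exists i, y.
  by apply/seteqP; split => z /=; rewrite in_itv/=.
case: b @Y mt => Y mt; first exact: mt.
rewrite [X in measurable_fun _ X](_ : _ = (fun z : Y => - time_coord false z)).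
  by apply: measurableT_comp => //; exact: oppr_measurable.
by apply/funext => z /=; rewrite /time_coord opprK.
Qed.

(** [lebesgue_st] is the outer extension of the Borel measure: its defining infimum provides
    countably many Borel sets that cover [E] with nearly the same total measure, and [G] is their
    union. *)
Lemma lebesgue_st_outer b (E : set (spacetime R n)) (e : R) :
  (lebesgue_st E < +oo)%E -> 0 < e -> exists G, [/\ E `<=` G, measurable G,
    <<s coord_halfspaces space_coord (time_coord b) >> G &
    (lebesgue_st G <= lebesgue_st E + e%:E)%E].
Proof.
move=> Eoo e0.
have Efin : lebesgue_st E \is a fin_num by rewrite ge0_fin_numE.
have [_ [A [mA EA] <-] Ae] := lb_ereal_inf_adherent e0 Efin.
have mUA : @measurable _ ('rV[R]_n * measurableTypeR R)%type (\bigcup_k A k).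
  exact: bigcupT_measurable.
exists (\bigcup_k A k); split => //.
- exact: borel_measurable_spacetime.
- exact: borel_coord_halfspaces.
- apply: le_trans (ltW Ae); rewrite lebesgue_st_borel//.
  exact: measure_sigma_subadditive.
Qed.

(** The sigma-algebra comes from the coordinates, so an open set is written as the union of the
    countably many cubes with rational centre and half side [1 / (k + 1)] that it contains. *)
Lemma measurable_open_rV (Omega : set 'rV[R]_n) : open Omega -> measurable Omega.
Proof.
move=> oO.
pose Q (c : {ffun 'I_n -> rat}) (k : nat) : set 'rV[R]_n :=
  [set x : 'rV[R]_n | forall i, `](ratr (c i) - k.+1%:R^-1), (ratr (c i) + k.+1%:R^-1)[%classic
    (x ord0 i : measurableTypeR R)].
have mQ c k : measurable (Q c k).
  by apply: (measurable_rV_box (A := fun i =>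
    `](ratr (c i) - k.+1%:R^-1), (ratr (c i) + k.+1%:R^-1)[%classic)).
pose F (j : nat) : set 'rV[R]_n := if unpickle j is Some (c, k) then
  (if `[< Q c k `<=` Omega >] then Q c k else set0) else set0.
have -> : Omega = \bigcup_j F j.
  apply/seteqP; split => [x Ox|x [j _]]; last first.
    by rewrite /F; case: unpickle => [[c k]|//]; case: asboolP => // QO /QO.
  have /nbhs_ballP[e /= e0 xe] := open_nbhs_nbhs (conj oO Ox).
  pose k := Num.truncn (2 / e).
  have ke : k.+1%:R^-1 * 2 < e.
    rewrite mulrC ltr_pdivrMr ?ltr0n// mulrC -ltr_pdivrMr//; exact: truncnS_gt.
  have k0 : 0 < k.+1%:R^-1 :> R by rewrite invr_gt0 ltr0n.
  set d := k.+1%:R^-1 in ke k0 *.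
  have cP i : {q : rat | `|x ord0 i - ratr q| < d}.
    apply: cid; have [|q] := @rat_in_itvoo R (x ord0 i - d) (x ord0 i + d).
      by rewrite ltrBlDr -addrA ltrDl addr_gt0.
    rewrite in_itv/= => /andP[q1 q2]; exists q.
    by rewrite ltr_norml; apply/andP; split; lra.
  pose c : {ffun 'I_n -> rat} := [ffun i => sval (cP i)].
  have xQ : Q c k x.
    move=> i /=; rewrite in_itv/= -/d ffunE.
    by have := svalP (cP i); rewrite ltr_norml => /andP[? ?]; apply/andP; split; lra.
  exists (pickle (c, k)) => //; rewrite /F pickleK; case: asboolP => // -[] y yQ.
  apply: xe; split => //= i0 i; rewrite ord1 /ball/=.
  have := yQ i; have := xQ i; rewrite /= !in_itv/= -/d => /andP[? ?] /andP[? ?].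
  by rewrite ltr_norml; apply/andP; split; lra.
apply: bigcupT_measurable => j; rewrite /F; case: unpickle => [[c k]|//].
by case: asboolP.
Qed.

Lemma measurable_cylinder (Omega : set 'rV[R]_n) (T : R) : open Omega ->
  measurable (cylinder Omega T).
Proof.
move=> oO; apply: borel_measurable_spacetime; apply: measurableX => //.
exact: measurable_open_rV.
Qed.

End spacetime_coordinates.

(** * Density with respect to nested countable partitions *)

Section countable_families.
Context {d : measure_display} {X : measurableType d} {R : realType}.
Variable mu : {measure set X -> \bar R}.

(** [pickle_inv] returns each index only once, so a disjoint family stays disjoint when enumerated
    by [nat]. *)
Let seq_of (T : countType) (D : set T) (F : T -> set X) (j : nat) : set X :=
  if (pickle_inv j : option T) is Some i then (if `[< D i >] then F i else set0) else set0.

Let seq_ofE (T : countType) (D : set T) (F : T -> set X) :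
  \bigcup_(i in D) F i = \bigcup_j seq_of D F j.
Proof.
apply/seteqP; split => [x [i Di Fx]|x [j _]].
  by exists (pickle i) => //; rewrite /seq_of pickleK_inv asboolT.
rewrite /seq_of; case: pickle_inv => // i; case: asboolP => // Di Fx.
by exists i.
Qed.

Let seq_of_measurable (T : countType) (D : set T) (F : T -> set X) :
  (forall i, D i -> measurable (F i)) -> forall j, measurable (seq_of D F j).
Proof.
move=> mF j; rewrite /seq_of; case: pickle_inv => // i.
by case: asboolP => // Di; exact: mF.
Qed.

Lemma measurable_bigcup_count (T : countType) (D : set T) (F : T -> set X) :
  (forall i, D i -> measurable (F i)) -> measurable (\bigcup_(i in D) F i).
Proof. by move=> mF; rewrite seq_ofE; exact/bigcupT_measurable/seq_of_measurable. Qed.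

(** The [F i] may overlap: subadditivity is used for them and additivity for the disjoint [G i]. *)
Lemma le_measure_bigcup (T : countType) (D : set T) (F G : T -> set X) (C : R) :
  0 <= C -> (forall i, D i -> measurable (F i)) ->
  (forall i, D i -> measurable (G i)) -> trivIset D G ->
  (forall i, D i -> (mu (F i) <= C%:E * mu (G i))%E) ->
  (mu (\bigcup_(i in D) F i) <= C%:E * mu (\bigcup_(i in D) G i))%E.
Proof.
move=> C0 mF mG tG FG; rewrite (seq_ofE D F) (seq_ofE D G).
have mF' := seq_of_measurable mF; have mG' := seq_of_measurable mG.
rewrite [in leRHS]measure_bigcup//; last first.
  apply/trivIsetP => j j' _ _ jj'; rewrite /seq_of.
  case E : pickle_inv => [i|]; last by rewrite set0I.
  case E' : pickle_inv => [i'|]; last by rewrite setI0.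
  case: asboolP => Di; last by rewrite set0I.
  case: asboolP => Di'; last by rewrite setI0.
  move/trivIsetP : tG; apply => //; apply: contra_neq jj' => ii'.
  have := @pickle_invK T j; have := @pickle_invK T j'.
  by rewrite E E' /= ii' => <- <-.
apply: (@le_trans _ _ (\sum_(j <oo) mu (seq_of D F j))%E).
  by apply: measure_sigma_subadditive => //; exact: bigcupT_measurable.
under [X in (_ * X)%E]eq_eseriesl do rewrite in_setT.
rewrite -nneseriesZl//; apply: lee_nneseries => // j _; rewrite /seq_of.
case: pickle_inv => [i|]; last by rewrite !measure0 mule0.
by case: asboolP => [|_]; [exact: FG|rewrite !measure0 mule0].
Qed.

End countable_families.

Section density.
Context {d : measure_display} {X : measurableType d} {R : realType} {I : countType}.
Variable mu : {measure set X -> \bar R}.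
Variable idx : nat -> X -> I.
Hypothesis measurable_cell : forall k i, measurable (idx k @^-1` [set i]).
Hypothesis idx_nested : forall k z w, idx k.+1 z = idx k.+1 w -> idx k z = idx k w.

Let sat k (F : set X) := forall z w, idx k z = idx k w -> F z -> F w.

Let satC k F : sat k F -> sat k (~` F).
Proof. by move=> sF z w zw nFz Fw; apply: nFz; exact: sF Fw. Qed.

Let satU k F G : sat k F -> sat k G -> sat k (F `|` G).
Proof. by move=> sF sG z w zw [/(sF _ _ zw)|/(sG _ _ zw)]; [left|right]. Qed.

Let sat_leq k l F : (k <= l)%N -> sat k F -> sat l F.
Proof.
move=> /subnK <-; elim: (l - k)%N => // j IH sF z w /idx_nested; exact: IH.
Qed.

Let sat_bigcup k F : sat k F -> F = \bigcup_(i in idx k @` F) (idx k @^-1` [set i]).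
Proof.
move=> sF; apply/seteqP; split => [z Fz|z [_ [w Fw <-] zw]].
  by exists (idx k z) => //; exists z.
by apply: sF Fw; rewrite -zw.
Qed.

Let sat_measurable k F : sat k F -> measurable F.
Proof. by move=> /sat_bigcup ->; apply: measurable_bigcup_count => i _. Qed.

Variable D : set X.
Hypothesis mD : measurable D.
Hypothesis Doo : (mu D < +oo)%E.

Let sdiff (E F : set X) := (E `\` F) `|` (F `\` E).

(** The sets that unions of cells of a single level approximate within [D]. They form a
    sigma-algebra, which contains everything generated by [gens]. *)
Let approx : set (set X) := [set E | measurable E /\ forall e : R, 0 < e ->
  exists k F, sat k F /\ (mu (D `&` sdiff E F) <= e%:E)%E].

Let sdiff_measurable E F : measurable E -> measurable F -> measurable (D `&` sdiff E F).
Proof.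
by move=> mE mF; apply: measurableI => //; apply: measurableU; exact: measurableD.
Qed.

Let approxU E E' : approx E -> approx E' -> approx (E `|` E').
Proof.
move=> [mE aE] [mE' aE']; split; first exact: measurableU.
move=> e e0; have e20 : 0 < e / 2 by rewrite divr_gt0.
have [k [F [sF Fe]]] := aE _ e20; have [k' [F' [sF' Fe']]] := aE' _ e20.
exists (maxn k k'), (F `|` F'); split.
  by apply: satU; [exact: sat_leq (leq_maxl _ _) _|exact: sat_leq (leq_maxr _ _) _].
have mF := sat_measurable sF; have mF' := sat_measurable sF'.
apply: (@le_trans _ _ (mu ((D `&` sdiff E F) `|` (D `&` sdiff E' F')))).
  apply: le_measure; rewrite ?inE.
  - by apply: sdiff_measurable; exact: measurableU.
  - by apply: measurableU; exact: sdiff_measurable.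
  - move=> z [Dz]; rewrite /sdiff/= => -[|] [] H /not_orP[? ?].
      by case: H => ?; [left|right]; split => //; left.
    by case: H => ?; [left|right]; split => //; right.
apply: (le_trans (measureU2 _ _ _)); [exact: sdiff_measurable..|].
by rewrite [e]splitr EFinD leeD.
Qed.

(** By continuity from above, which uses that [D] has finite measure, a finite union already fills
    the countable one up to a small part of [D]. *)
Let approx_bigcup (E : (set X)^nat) : (forall i, approx (E i)) -> approx (\bigcup_i E i).
Proof.
move=> aE; have mE i : measurable (E i) by have [] := aE i.
split; first exact: bigcupT_measurable.
move=> e e0; have e20 : 0 < e / 2 by rewrite divr_gt0.
pose S m := \big[setU/set0]_(i < m) E i.
have mS m : measurable (S m) by exact: bigsetU_measurable.
have aS m : approx (S m.+1).
  elim: m => [|m IH]; first by rewrite /S big_ord_recr big_ord0/= set0U.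
  by rewrite /S big_ord_recr; exact: approxU.
pose T m := D `&` (\bigcup_i E i `\` S m.+1).
have mT m : measurable (T m).
  by apply: measurableI => //; apply: measurableD => //; exact: bigcupT_measurable.
have T0 : \bigcap_m T m = set0.
  rewrite -subset0 => z Tz; have [_ [[i _ Ei] _]] := Tz 0%N Logic.I.
  have [_ [_]] := Tz i Logic.I; apply; rewrite /S -bigcup_mkord.
  by exists i => //=.
have /fine_cvgP[_ /cvgrPdist_lt /(_ _ e20)[m _ /(_ m (leqnn m))]] :
    mu (T k) @[k --> \oo] --> 0%E.
  have -> : 0%E = mu (\bigcap_m T m) by rewrite T0 measure0.
  apply: nonincreasing_cvg_mu => //.
  - by apply: le_lt_trans Doo; apply: le_measure; rewrite ?inE// => z [].
  - by rewrite T0.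
  - move=> a b ab; apply/subsetPset => z [Dz [Ez Sz]]; split => //; split => // Sz'.
    move: Sz' Sz; rewrite /S -!bigcup_mkord => -[i /= im Ei]; apply.
    by exists i => //=; exact: leq_trans im _.
rewrite sub0r normrN => Tm.
have [k [F [sF Fe]]] := (aS m).2 _ e20; have mF := sat_measurable sF.
exists k, F; split => //.
apply: (@le_trans _ _ (mu (T m `|` (D `&` sdiff (S m.+1) F)))).
  apply: le_measure; rewrite ?inE.
  - by apply: sdiff_measurable => //; exact: bigcupT_measurable.
  - by apply: measurableU => //; exact: sdiff_measurable.
  - move=> z [Dz]; rewrite /T /sdiff/= => -[[Ez nFz]|[Fz nEz]].
      have [Sz|nSz] := pselect (S m.+1 z); last by left; split.
      by right; split => //; left.
    right; split => //; right; split => // Sz; apply: nEz; move: Sz.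
    by rewrite /S -bigcup_mkord => -[i _ ?]; exists i.
apply: (le_trans (measureU2 _ _ _)) => //; first exact: sdiff_measurable.
rewrite [e]splitr EFinD leeD//.
have Tfin : mu (T m) \is a fin_num.
  rewrite ge0_fin_numE//; apply: le_lt_trans Doo.
  by apply: le_measure; rewrite ?inE// => z [].
apply: (@le_trans _ _ (fine (mu (T m)))%:E); first by rewrite fineK.
rewrite lee_fin; apply: ltW; exact: le_lt_trans (ler_norm _) Tm.
Qed.

Let approx_sigma_algebra : sigma_algebra [set: X] approx.
Proof.
split.
- split => // e e0; exists 0%N, set0; split => //.
  by rewrite /sdiff setDv setU0 setI0 measure0 lee_fin ltW.
- move=> E [mE aE]; rewrite setTD; split; first exact: measurableC.
  move=> e /aE[k [F [sF Fe]]]; exists k, (~` F); split; first exact: satC.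
  suff -> : sdiff (~` E) (~` F) = sdiff E F by [].
  by rewrite /sdiff !setDE !setCK setUC [~` F `&` _]setIC [~` E `&` _]setIC.
- exact: approx_bigcup.
Qed.

Variable gens : set (set X).
Hypothesis gens_cells : forall A, gens A -> exists F : (set X)^nat,
  A = \bigcup_k F k /\ forall k z w, idx k z = idx k w -> F k z -> F k w.

Let gens_approx : <<s gens >> `<=` approx.
Proof.
apply: smallest_sub => // A /gens_cells[F [-> sF]].
apply: approx_bigcup => k; split.
  by apply: (@sat_measurable k); exact: sF.
move=> e e0; exists k, (F k); split; first exact: sF.
by rewrite /sdiff setDv setU0 setI0 measure0 lee_fin ltW.
Qed.

(* A weak form of the Lebesgue density theorem for the cells of [idx]. *)
Lemma null_set_of_cells (A : set X) : measurable A -> A `<=` D ->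
  (forall e : R, 0 < e -> exists G, [/\ A `<=` G, measurable G, <<s gens >> G &
    (mu G <= mu A + e%:E)%E]) ->
  (forall k i, (mu (A `&` idx k @^-1` [set i]) <=
     2^-1%:E * mu (D `&` idx k @^-1` [set i]))%E) ->
  mu A = 0%E.
Proof.
move=> mA AD outer half.
have Afin : mu A \is a fin_num.
  by rewrite ge0_fin_numE//; apply: le_lt_trans Doo; apply: le_measure; rewrite ?inE.
have satA k F : sat k F -> (mu (A `&` F) <= 2^-1%:E * mu (D `&` F))%E.
  move=> /sat_bigcup ->; rewrite !setI_bigcupr; apply: le_measure_bigcup => //.
  - by move=> i _; exact: measurableI.
  - by move=> i _; exact: measurableI.
  - by apply/trivIsetP => i j _ _ ij; rewrite setIACA [X in _ `&` X](_ : _ = set0)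
      ?setI0// -subset0 => z [/= -> ji]; move/eqP: ij.
(* Up to [e], [A] lies in a union [F] of cells, [A] fills at most half of [D] inside [F], and that
   part of [D] is hardly larger than [G], hence than [A]. So [mu A] is at most half of itself up to
   a multiple of [e]. *)
have key (e : R) : 0 < e -> (mu A <= (3 * e)%:E + 2^-1%:E * mu A)%E.
  move=> e0; have [G [AG mG /gens_approx[_ /(_ _ e0)[k [F [sF Fe]]]] Ge]] := outer _ e0.
  have mF := sat_measurable sF.
  have mDs : measurable (D `&` sdiff G F) by exact: sdiff_measurable.
  have AGF : (mu A <= mu (A `&` F) + mu (D `&` sdiff G F))%E.
    apply: le_trans (measureU2 _ _ _) => //; last exact: measurableI.
    apply: le_measure; rewrite ?inE//; first by apply: measurableU => //; exact: measurableI.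
    move=> z Az; have [Fz|nFz] := pselect (F z); first by left.
    by right; split; [exact: AD|left; split => //; exact: AG].
  have DFG : (mu (D `&` F) <= mu G + mu (D `&` sdiff G F))%E.
    apply: le_trans (measureU2 _ _ _) => //.
    apply: le_measure; rewrite ?inE//; [exact: measurableI|exact: measurableU|].
    move=> z [Dz Fz]; have [Gz|nGz] := pselect (G z); first by left.
    by right; split => //; right.
  have : (mu A <= 2^-1%:E * (mu A + e%:E + e%:E) + e%:E)%E.
    apply: (le_trans AGF); apply: leeD => //.
    apply: (le_trans (satA _ _ sF)); rewrite lee_pmul2l//.
    by apply: (le_trans DFG); apply: leeD.
  move: Afin; case: (mu A) => [a| |]// _.
  by rewrite -!(EFinD, EFinM) !lee_fin => H; lra.
apply/eqP; rewrite eq_le measure_ge0 andbT; apply/lee_addgt0Pr => e e0.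
have := key (e / 6); rewrite divr_gt0// => /(_ isT).
rewrite add0e; move: Afin; case: (mu A) => [a| |]// _.
by rewrite -!(EFinD, EFinM) !lee_fin => H; lra.
Qed.

End density.

(** * Exponential decay and change of lag *)

Lemma powR_nat_expr_ge (R : realType) (m k : nat) (p : R) : (0 < m)%N -> 1 <= p ->
  (m ^ k)%:R <= (m ^ k)%:R `^ p.
Proof. by move=> m0 p1; rewrite le1r_powR// ler1n expn_gt0 m0. Qed.

(** The bounds that the coarse floor gives for [y / e] are integers, so they also bound the floor of
    [y / e]. *)
Lemma floor_div_nat_bounds (R : realType) (y e : R) (r : nat) : 0 < e -> (0 < r)%N ->
  Num.floor (y / (r%:R * e)) * r <= Num.floor (y / e) < (Num.floor (y / (r%:R * e)) + 1) * r.
Proof.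
move=> e0 r0; have r0' : 0 < r%:R :> R by rewrite ltr0n.
set j := Num.floor (y / _).
have /andP[j1 j2] : j%:~R <= y / (r%:R * e) < (j + 1)%:~R by exact: Num.Theory.floor_itv.
rewrite Num.Theory.floor_ge_int Num.Theory.floor_lt_int !intrM -!pmulrn.
rewrite ler_pdivlMr// ltr_pdivrMr//; move: j1 j2.
rewrite ler_pdivlMr ?mulr_gt0// ltr_pdivrMr ?mulr_gt0//.
by rewrite !mulrA => -> ->.
Qed.

Lemma floor_div_eq (R : realType) (a y e : R) (j : int) : 0 < e ->
  (Num.floor ((y - a) / e) == j) = (a + j%:~R * e <= y < a + j%:~R * e + e).
Proof.
move=> e0; rewrite Num.Theory.floor_eq ler_pdivlMr// ltr_pdivrMr// intrD.
by rewrite lerBrDl ltrBlDl mulrDl mul1r addrA.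
Qed.

Lemma floor_div_nested (R : realType) (y y' e : R) (r : nat) : 0 < e -> (0 < r)%N ->
  Num.floor (y / e) = Num.floor (y' / e) ->
  Num.floor (y / (r%:R * e)) = Num.floor (y' / (r%:R * e)).
Proof.
move=> e0 r0 yy'.
have /andP[a1 a2] := floor_div_nat_bounds y e0 r0.
have /andP[b1 b2] := floor_div_nat_bounds y' e0 r0.
rewrite yy' in a1 a2; have r0' : 0 < r%:Z by [].
have := le_lt_trans a1 b2; have := le_lt_trans b1 a2.
by rewrite !ltr_pM2r// !ltzD1 => ? ?; apply/eqP; rewrite eq_le; apply/andP.
Qed.

Lemma floor_div_refine (R : realType) (y e : R) (r : nat) : 0 < e -> (0 < r)%N ->
  (Num.floor (y / (r%:R * e)))%:~R * (r%:R * e) <= (Num.floor (y / e))%:~R * e /\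
  (Num.floor (y / e))%:~R * e + e <=
    (Num.floor (y / (r%:R * e)))%:~R * (r%:R * e) + r%:R * e.
Proof.
move=> e0 r0; have /andP[] := floor_div_nat_bounds y e0 r0.
rewrite -lezD1 -!(ler_int R) !intrM !intrD -!pmulrn => h1 h2; split.
  by rewrite mulrA ler_pM2r.
set f := _%:~R in h2 *; set F := _%:~R in h2 *.
rewrite (_ : f * e + e = (f + 1) * e); last by ring.
by rewrite (_ : _ + r%:R * e = (F + 1) * r%:R * e) ?ler_pM2r//; ring.
Qed.

(** * Parabolic rectangles in abstract coordinates and the linking of their constants *)

Section parabolic_geometry.
Context {R : realType} {d : measure_display} {X : measurableType d} {n : nat}.
Variables (mu : {measure set X -> \bar R}) (xs : X -> 'I_n -> R) (tm : X -> R).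
Variables (p gamma : R).
Implicit Types (x : 'I_n -> R) (t L u v : R).

Definition slab (x : 'I_n -> R) (L : R) (cu cv : bool) (u v : R) : set X :=
  cbox xs tm true false (fun i => x i - L) (fun i => x i + L) cu cv u v.

Definition rect x t L := slab x L false true (t - L `^ p) (t + L `^ p).
Definition upper x t L := slab x L false true (t + gamma * L `^ p) (t + L `^ p).
Definition lower x t L := slab x L false true (t - L `^ p) (t - gamma * L `^ p).

(** With this ratio [top] is the later half of [upper]. It is closed at its start, so that half-open
    grid cells fit in it. *)
Definition top_ratio := (1 - gamma) / 2.
Definition top x t L :=
  slab x L true true (t + L `^ p - top_ratio * L `^ p) (t + L `^ p).

Hypothesis measurable_cbox : forall ca cb a b cu cv u v,
  measurable (cbox xs tm ca cb a b cu cv u v).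
Hypothesis measure_cbox : forall ca cb a b cu cv u v,
  (forall i, a i <= b i) -> u <= v ->
  mu (cbox xs tm ca cb a b cu cv u v) = (\prod_(i < n) (b i - a i) * (v - u))%:E.

Lemma measurable_slab x L cu cv u v : measurable (slab x L cu cv u v).
Proof. exact: measurable_cbox. Qed.

Lemma measure_slab x L cu cv u v : 0 <= L -> u <= v ->
  mu (slab x L cu cv u v) = ((2 * L) ^+ n * (v - u))%:E.
Proof.
move=> L0 uv; rewrite measure_cbox//; last by move=> i; lra.
rewrite (eq_bigr (fun=> 2 * L)); last by move=> i _; ring.
by rewrite prodr_const card_ord.
Qed.

Lemma slab_subset x L cu cv u v x' L' cu' cv' u' v' :
  (forall i, x' i - L' <= x i - L /\ x i + L <= x' i + L') ->
  (u' < u \/ (u' <= u /\ (cu ==> cu'))) -> (v < v' \/ (v <= v' /\ (cv' ==> cv))) ->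
  slab x L cu cv u v `<=` slab x' L' cu' cv' u' v'.
Proof.
move=> xx' uu' vv' z [zx]; rewrite /slab/cbox/= !in_itv/= => /andP[zu zv]; split.
  move=> i; have [? ?] := xx' i; move: (zx i); rewrite !in_itv/= => /andP[? ?].
  by apply/andP; split; lra.
apply/andP; split.
  case: cu uu' zu => uu' /= zu; case: cu' uu' => /= uu'; case: uu' => [?|[? //]] //; lra.
case: cv vv' zv => vv' /= zv; case: cv' vv' => /= vv'; case: vv' => [?|[? //]] //; lra.
Qed.

Variables (Q : set X) (g : X -> \bar R) (B s : R) (c : ('I_n -> R) -> R -> R -> R).
Hypotheses (gamma_gt0 : 0 < gamma) (gamma_lt1 : gamma < 1) (p_gt1 : 1 < p).
Hypotheses (B_ge0 : 0 <= B) (s_ge0 : 0 <= s).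

(* [c x t L] plays the role of the constant of the rectangle [rect x t L]. *)
Record osc_control := OscControl {
  measurable_gt : forall E (a : R), measurable E -> E `<=` Q ->
    measurable (E `&` [set z | (a%:E < g z)%E]);
  measurable_lt : forall E (a : R), measurable E -> E `<=` Q ->
    measurable (E `&` [set z | (g z < a%:E)%E]);
  upper_control : forall x t L, 0 < L -> rect x t L `<=` Q ->
    (mu (upper x t L `&` [set z | ((c x t L + B)%:E < g z)%E]) <= s%:E * mu (upper x t L))%E;
  lower_control : forall x t L, 0 < L -> rect x t L `<=` Q ->
    (mu (lower x t L `&` [set z | (g z < (c x t L - B)%:E)%E]) <= s%:E * mu (lower x t L))%E }.

Hypothesis osc : osc_control.

Lemma upper_rect x t L : 0 < L -> upper x t L `<=` rect x t L.
Proof.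
move=> L0; have Lp : 0 < L `^ p by exact: powR_gt0.
have gLp : 0 < gamma * L `^ p by exact: mulr_gt0.
by apply: slab_subset => //; [left; lra|right].
Qed.

Lemma lower_rect x t L : 0 < L -> lower x t L `<=` rect x t L.
Proof.
move=> L0; have Lp : 0 < L `^ p by exact: powR_gt0.
have gLp : 0 < gamma * L `^ p by exact: mulr_gt0.
by apply: slab_subset => //; [right|left; lra].
Qed.

Lemma top_upper x t L : 0 < L -> top x t L `<=` upper x t L.
Proof.
move=> L0; have Lp : 0 < L `^ p by exact: powR_gt0.
have gLp : 0 < (1 - gamma) * L `^ p by rewrite mulr_gt0// subr_gt0.
by apply: slab_subset => //; [left; rewrite /top_ratio; lra|right].
Qed.

Lemma measure_upper x t L : 0 < L ->
  mu (upper x t L) = ((2 * L) ^+ n * ((1 - gamma) * L `^ p))%:E.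
Proof.
move=> L0; have Lp : 0 < L `^ p by exact: powR_gt0.
have gLp : 0 < (1 - gamma) * L `^ p by rewrite mulr_gt0// subr_gt0.
by rewrite measure_slab; [congr (_ * _)%:E; ring|lra|lra].
Qed.

Lemma measure_lower x t L : 0 < L ->
  mu (lower x t L) = ((2 * L) ^+ n * ((1 - gamma) * L `^ p))%:E.
Proof.
move=> L0; have Lp : 0 < L `^ p by exact: powR_gt0.
have gLp : 0 < (1 - gamma) * L `^ p by rewrite mulr_gt0// subr_gt0.
by rewrite measure_slab; [congr (_ * _)%:E; ring|lra|lra].
Qed.

Lemma measure_top x t L : 0 < L ->
  mu (top x t L) = ((2 * L) ^+ n * (top_ratio * L `^ p))%:E.
Proof.
move=> L0; have Lp : 0 < L `^ p by exact: powR_gt0.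
have gLp : 0 < (1 - gamma) * L `^ p by rewrite mulr_gt0// subr_gt0.
by rewrite measure_slab; [congr (_ * _)%:E; ring|lra|rewrite /top_ratio; lra].
Qed.

(* On a large enough overlap some point sees both constants, so that constants
   increase by at most [2 * B] when going up in time. *)
Lemma link x1 (t1 L1 : R) x2 (t2 L2 : R) O : 0 < L1 -> 0 < L2 ->
  rect x1 t1 L1 `<=` Q -> rect x2 t2 L2 `<=` Q -> measurable O ->
  O `<=` upper x1 t1 L1 -> O `<=` lower x2 t2 L2 ->
  (s%:E * mu (upper x1 t1 L1) + s%:E * mu (lower x2 t2 L2) < mu O)%E ->
  c x2 t2 L2 <= c x1 t1 L1 + 2 * B.
Proof.
move=> L10 L20 R1 R2 mO O1 O2; apply: contraPP => /negP; rewrite -ltNge => cc.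
apply/negP; rewrite -leNgt.
have m1 : measurable (upper x1 t1 L1 `&` [set z | ((c x1 t1 L1 + B)%:E < g z)%E]).
  apply: (measurable_gt osc); first exact: measurable_slab.
  by apply: subset_trans R1; exact: upper_rect.
have m2 : measurable (lower x2 t2 L2 `&` [set z | (g z < (c x2 t2 L2 - B)%:E)%E]).
  apply: (measurable_lt osc); first exact: measurable_slab.
  by apply: subset_trans R2; exact: lower_rect.
apply: le_trans (leeD (upper_control osc L10 R1) (lower_control osc L20 R2)).
apply: le_trans (measureU2 _ m1 m2).
apply: le_measure; rewrite ?inE//; first exact: measurableU.
(* Here [c x1 t1 L1 + B] is below [c x2 t2 L2 - B], so each point of [O] is exceptional for one of
   the two rectangles. *)
move=> z Oz; have [gz|gz] := ltP (c x1 t1 L1 + B)%:E (g z).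
  by left; split => //; exact: O1.
right; split; first exact: O2.
by apply: le_lt_trans gz _; rewrite lte_fin; lra.
Qed.

(** * The tree of grid cells in the top of a rectangle, and one step of decay *)

Section stopping_tree.
Variables (m : nat) (x : 'I_n -> R) (t L : R).
Hypotheses (m_ge2 : (2 <= m)%N) (m_large : 4 <= (1 - gamma) * m%:R).
Hypotheses (L_gt0 : 0 < L) (rectQ : rect x t L `<=` Q).

Let side k : R := L / (m ^ k)%:R.
(** The power [p] of [m ^ k] need not be an integer. Rounding up to a power of two keeps the time
    slices nested, and their height [tau k] between half of [top_ratio * side k ^ p] and all of
    it. *)
Let nslices k : nat := 2 ^ up_log 2 `|Num.ceil ((m ^ k)%:R `^ p : R)|.
Let tau k : R := top_ratio * L `^ p / (nslices k)%:R.
Let t0 : R := t + L `^ p - top_ratio * L `^ p.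

Let m_gt0 : (0 < m)%N. Proof. exact: ltnW. Qed.

Let mk_gt0 k : 0 < (m ^ k)%:R :> R.
Proof. by rewrite ltr0n expn_gt0 m_gt0. Qed.

Let side_gt0 k : 0 < side k.
Proof. by rewrite divr_gt0. Qed.

Let Lp_gt0 : 0 < L `^ p. Proof. exact: powR_gt0. Qed.

Let side_powR k : side k `^ p = L `^ p / (m ^ k)%:R `^ p.
Proof. by rewrite powRM ?invr_ge0 ?ltW// -powR_inv1 ?ltW// -powRrM mulN1r powRN. Qed.

Let sidep_gt0 k : 0 < side k `^ p. Proof. exact: powR_gt0. Qed.

Let nslices_bounds k :
  (m ^ k)%:R `^ p <= (nslices k)%:R :> R /\ (nslices k)%:R <= 2 * (m ^ k)%:R `^ p :> R.
Proof.
set a := _ `^ p; have a1 : 1 <= a.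
  apply: le_trans (powR_nat_expr_ge k m_gt0 (ltW p_gt1)).
  by rewrite ler1n expn_gt0 m_gt0.
rewrite /nslices -/a; set b := `|Num.ceil a|%N.
have bE : b%:R = (Num.ceil a)%:~R :> R.
  have c0 : 0 <= Num.ceil a by rewrite -(ler_int R) (le_trans _ (Num.Theory.ceil_ge a))// (le_trans _ a1).
  by rewrite -[in RHS](gez0_abs c0) -pmulrn.
have ab : a <= b%:R by rewrite bE Num.Theory.ceil_ge.
split.
  by apply: (le_trans ab); rewrite ler_nat up_logP.
have [b1|b1] := leqP b 1%N.
  have -> : up_log 2 b = 0%N by apply/eqP; rewrite up_log_eq0 b1 orbT.
  by rewrite expn0; lra.
(* By minimality of the exponent, half of the power of two is strictly below the integer [b], hence
   at most [b - 1], which is less than [a]. *)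
have := up_log_gtn (isT : (1 < 2)%N) b1.
rewrite -(prednK (_ : 0 < up_log 2 b)%N) ?up_log_gt0//= expnS -(ler_nat R) natrM.
have : b%:R - 1 < a by rewrite bE -[1]/(1%:~R) -intrB Num.Theory.ceilB1_lt.
set w := (2 ^ _)%N; rewrite -addn1 natrD => b1a wb.
by rewrite ler_pM2l// ltW// (le_lt_trans _ b1a)// lerBrDr.
Qed.

Let nslices_gt0 k : 0 < (nslices k)%:R :> R.
Proof. by rewrite ltr0n expn_gt0. Qed.

Let top_ratio_gt0 : 0 < top_ratio. Proof. by rewrite divr_gt0 ?subr_gt0. Qed.

Let topLp_gt0 : 0 < top_ratio * L `^ p. Proof. exact: mulr_gt0. Qed.

Let tau_gt0 k : 0 < tau k.
Proof. exact: divr_gt0. Qed.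

Let tau_le k : tau k <= top_ratio * side k `^ p.
Proof.
rewrite side_powR mulrA; have [N1 _] := nslices_bounds k.
by rewrite /tau (ler_pM2l topLp_gt0) lef_pV2 ?posrE ?powR_gt0.
Qed.

Let tau_ge k : top_ratio * side k `^ p <= 2 * tau k.
Proof.
rewrite side_powR mulrA /tau mulrCA (ler_pM2l topLp_gt0).
have [_ N2] := nslices_bounds k; have ap : 0 < (m ^ k)%:R `^ p :> R by exact: powR_gt0.
by rewrite ler_pdivlMr// mulrC ler_pdivrMr.
Qed.

Let side0 : side 0 = L. Proof. by rewrite /side expn0 divr1. Qed.

Let sideS k : side k = m%:R * side k.+1.
Proof.
have m0 : m%:R != 0 :> R by rewrite pnatr_eq0 -lt0n.
by rewrite /side expnS natrM; field; rewrite m0/= gt_eqF.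
Qed.

Let tau0 : tau 0 = top_ratio * L `^ p.
Proof.
by rewrite /tau /nslices expn0 powR1 Num.Theory.ceil1 up_log1 divr1.
Qed.

Let slice_ratio k : exists2 r, (0 < r)%N & tau k = r%:R * tau k.+1.
Proof.
pose e j := up_log 2 `|Num.ceil ((m ^ j)%:R `^ p : R)|.
have ek : (e k <= e k.+1)%N.
  apply: leq_up_log; rewrite -lez_nat !gez0_abs.
  - apply: Num.Theory.le_ceil; apply: ge0_ler_powR; rewrite ?nnegrE ?ler0n//.
      by rewrite ltW// (lt_trans _ p_gt1).
    by rewrite ler_nat leq_exp2l.
  - by rewrite -(ler_int R) (le_trans _ (Num.Theory.ceil_ge _))// powR_ge0.
  - by rewrite -(ler_int R) (le_trans _ (Num.Theory.ceil_ge _))// powR_ge0.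
exists (2 ^ (e k.+1 - e k))%N; first by rewrite expn_gt0.
rewrite /tau; have -> : nslices k.+1 = (2 ^ (e k.+1 - e k) * nslices k)%N.
  by rewrite /nslices -expnD subnK.
rewrite natrM; set r := (2 ^ _)%:R; have r0 : r != 0 by rewrite pnatr_eq0 expn_eq0.
have := nslices_gt0 k; move: (_%:R) r r0 => N r r0 N0.
by field; rewrite r0/= gt_eqF.
Qed.

Let side_powRS k : side k `^ p = m%:R `^ p * side k.+1 `^ p.
Proof. by rewrite sideS powRM ?ler0n// ltW. Qed.

Let sidepS k : 4 * side k.+1 `^ p <= (1 - gamma) * side k `^ p.
Proof.
rewrite (side_powRS k) mulrA ler_pM2r//; apply: (le_trans m_large).
by rewrite ler_pM2l ?subr_gt0// le1r_powR ?ler1n// ltW.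
Qed.

(** The grid starts at the first corner of the top and extends over all of [X], so lowered cells
    have indices too; the points of the tree are those with index [j0] at level 0. *)
Let idx k z : {ffun 'I_n -> int} * int :=
  ([ffun i => Num.floor ((xs z i - (x i - L)) / (2 * side k))],
   Num.floor ((tm z - t0) / tau k)).

Let space_lo k (j : {ffun 'I_n -> int} * int) i : R :=
  x i - L + (j.1 i)%:~R * (2 * side k).

Let time_lo k (j : {ffun 'I_n -> int} * int) : R := t0 + j.2%:~R * tau k.

Let cell k j : set X := cbox xs tm true true
  (space_lo k j) (fun i => space_lo k j i + 2 * side k)
  true true (time_lo k j) (time_lo k j + tau k).

Let side2_gt0 k : 0 < 2 * side k. Proof. by rewrite mulr_gt0. Qed.

Let cellP k z j : cell k j z <-> idx k z = j.
Proof.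
split => [[zx]|<-].
  rewrite in_itv/= => zt; case: j zx zt => j1 j2 zx zt.
  congr pair; last by apply/eqP; rewrite floor_div_eq.
  apply/ffunP => i; rewrite ffunE; apply/eqP; rewrite floor_div_eq//.
  by have := zx i; rewrite in_itv.
split => [i|]; rewrite in_itv/=.
  by rewrite /space_lo ffunE -floor_div_eq.
by rewrite -floor_div_eq.
Qed.

Let cell_preimage k j : idx k @^-1` [set j] = cell k j.
Proof. by apply/seteqP; split => z /cellP. Qed.

Let measure_cell k j : mu (cell k j) = ((2 * side k) ^+ n * tau k)%:E.
Proof.
rewrite measure_cbox; last 2 first.
- by move=> i; rewrite lerDl ltW.
- by rewrite lerDl ltW.
rewrite (eq_bigr (fun=> 2 * side k)); last by move=> i _; ring.
by rewrite prodr_const card_ord; congr (_ * _)%:E; ring.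
Qed.

Let side2S k : 2 * side k = m%:R * (2 * side k.+1).
Proof. by rewrite sideS mulrCA. Qed.

(** Columns are treated apart from times because a lowered cell shares only its column with the
    stopped cell it comes from. *)
Let space_nested l k z w i : (l <= k)%N ->
  (idx k z).1 i = (idx k w).1 i -> (idx l z).1 i = (idx l w).1 i.
Proof.
move=> /subnK <-; elim: (k - l)%N => // e IH; rewrite addSn => zw; apply: IH.
by move: zw; rewrite /= !ffunE (side2S (e + l)); exact: floor_div_nested.
Qed.

Let time_nested l k z w : (l <= k)%N ->
  (idx k z).2 = (idx k w).2 -> (idx l z).2 = (idx l w).2.
Proof.
move=> /subnK <-; elim: (k - l)%N => // e IH; rewrite addSn => zw; apply: IH.
have [r r0 E] := slice_ratio (e + l).
by move: zw; rewrite /= E; exact: floor_div_nested.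
Qed.

Let idx_nested l k z w : (l <= k)%N -> idx k z = idx k w -> idx l z = idx l w.
Proof.
move=> lk zw; apply/eqP/andP; split; apply/eqP.
  by apply/ffunP => i; apply: (space_nested lk); rewrite zw.
by apply: (time_nested lk); rewrite zw.
Qed.

Let space_refine l k z i : (l <= k)%N ->
  space_lo l (idx l z) i <= space_lo k (idx k z) i /\
  space_lo k (idx k z) i + 2 * side k <= space_lo l (idx l z) i + 2 * side l.
Proof.
move=> /subnK <-; elim: (k - l)%N => // e [IH1 IH2]; rewrite addSn.
have [h1 h2] := floor_div_refine (xs z i - (x i - L)) (side2_gt0 (e + l).+1) m_gt0.
rewrite -side2S in h1 h2; move: IH1 IH2; rewrite /space_lo /= !ffunE => IH1 IH2.
by split; [apply: (le_trans IH1)|apply: le_trans IH2];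
  rewrite -?[_ + _ * _ + _]addrA lerD2l.
Qed.

Let time_refine l k z : (l <= k)%N ->
  time_lo l (idx l z) <= time_lo k (idx k z) /\
  time_lo k (idx k z) + tau k <= time_lo l (idx l z) + tau l.
Proof.
move=> /subnK <-; elim: (k - l)%N => // e [IH1 IH2]; rewrite addSn.
have [r r0 E] := slice_ratio (e + l).
have [h1 h2] := floor_div_refine (tm z - t0) (tau_gt0 (e + l).+1) r0.
rewrite -E in h1 h2; move: IH1 IH2; rewrite /time_lo /= => IH1 IH2.
by split; [apply: (le_trans IH1)|apply: le_trans IH2];
  rewrite -?[_ + _ * _ + _]addrA lerD2l.
Qed.

(* The rectangle of a cell is aligned with it at the top. *)
Let ctr k j : 'I_n -> R := fun i => space_lo k j i + side k.
Let ctime k j : R := time_lo k j + tau k - side k `^ p.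
Let C k j := c (ctr k j) (ctime k j) (side k).
Let c0 := c x t L.

Let cell_top k j : cell k j `<=` top (ctr k j) (ctime k j) (side k).
Proof.
move=> z [zx zt]; split.
  move=> i; have := zx i; rewrite !in_itv/= => /andP[? ?]; rewrite /ctr.
  by apply/andP; split; lra.
move: zt; rewrite !in_itv/= => /andP[? ?]; rewrite /ctime.
by have h := tau_le k; rewrite subrK; apply/andP; split; lra.
Qed.

Let j0 : {ffun 'I_n -> int} * int := ([ffun=> 0], 0).

Let ctr0 : ctr 0 j0 = x.
Proof. by apply/funext => i; rewrite /ctr /space_lo ffunE mul0r addr0 side0; ring. Qed.

Let ctime0 : ctime 0 j0 = t.
Proof. by rewrite /ctime /time_lo /= mul0r addr0 tau0 side0 /t0; ring. Qed.

Let C0 : C 0 j0 = c0. Proof. by rewrite /C ctr0 ctime0 side0. Qed.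

Let rect_of k j := rect (ctr k j) (ctime k j) (side k).

(** The upper part has height [(1 - gamma) * side k ^ p]. The parent cell takes at most the later
    half of it; the rectangle of the child, of height [2 * side k.+1 ^ p], reaches down by at most
    the other half, by [m_large]. *)
Let rect_upper k z :
  rect_of k.+1 (idx k.+1 z) `<=` upper (ctr k (idx k z)) (ctime k (idx k z)) (side k).
Proof.
apply: slab_subset.
- by move=> i; have [? ?] := space_refine z i (leqnSn k); rewrite /ctr; split; lra.
- right; split => //; rewrite /ctime.
  have [h1 h2] := time_refine z (leqnSn k).
  have := tau_le k; have := sidepS k; have := tau_gt0 k.+1; have := sidepS k.
  rewrite /top_ratio; lra.
- right; split => //; rewrite /ctime.
  have [h1 h2] := time_refine z (leqnSn k); lra.
Qed.

Let rect_sub k z : idx 0 z = j0 -> rect_of k (idx k z) `<=` rect x t L.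
Proof.
move=> z0; elim: k => [|k IH].
  by rewrite z0 /rect_of ctr0 ctime0 side0.
apply: subset_trans (@rect_upper k z) _.
by apply: subset_trans IH; exact: upper_rect.
Qed.

Let rect_subS k z : idx 0 z = j0 -> rect_of k.+1 (idx k.+1 z) `<=` upper x t L.
Proof.
move=> z0; elim: k => [|k IH].
  by apply: subset_trans (@rect_upper 0 z) _; rewrite z0 ctr0 ctime0 side0.
apply: subset_trans (@rect_upper k.+1 z) _.
by apply: subset_trans IH; exact: upper_rect.
Qed.

Let rect_Q k z : idx 0 z = j0 -> rect_of k (idx k z) `<=` Q.
Proof. by move=> z0; apply: subset_trans rectQ; exact: rect_sub. Qed.

Hypothesis s_link : s * ((m%:R) ^+ n * m%:R `^ p + 1) < 1.

(** The overlap is the whole lower part of the child's rectangle. The upper part of the parent's is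
    [m ^ n * m ^ p] times as large, which is the ratio in [s_link]. *)
Let C_step k z : idx 0 z = j0 -> C k.+1 (idx k.+1 z) <= C k (idx k z) + 2 * B.
Proof.
move=> z0; apply: (link (O := lower (ctr k.+1 (idx k.+1 z)) (ctime k.+1 (idx k.+1 z)) (side k.+1))) => //.
- exact: rect_Q.
- exact: rect_Q.
- exact: measurable_slab.
- by apply: subset_trans (@rect_upper k z); exact: lower_rect.
rewrite measure_upper// measure_lower// -!EFinM -EFinD lte_fin.
rewrite (side2S k) exprMn (side_powRS k).
set V := (2 * side k.+1) ^+ n; set P := side k.+1 `^ p.
have VP : 0 < V * ((1 - gamma) * P).
  by rewrite !mulr_gt0// ?subr_gt0// ?exprn_gt0// powR_gt0.
rewrite [ltLHS](_ : _ = s * (m%:R ^+ n * m%:R `^ p + 1) * (V * ((1 - gamma) * P))).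
  by rewrite -[ltRHS]mul1r ltr_pM2r.
ring.
Qed.

Let stop k z := [/\ idx 0 z = j0, c0 + 2 * B < C k (idx k z) &
  forall l, (l < k)%N -> C l (idx l z) <= c0 + 2 * B].

Let stop_idx k z w : idx k z = idx k w -> stop k z -> stop k w.
Proof.
move=> zw [z0 Cz lz]; split.
- by rewrite -(idx_nested (leq0n k) zw).
- by rewrite -zw.
- by move=> l lk; rewrite -(idx_nested (ltnW lk) zw); exact: lz.
Qed.

Let stop_gt0 k z : stop k z -> (0 < k)%N.
Proof.
case: k => // -[z0 + _]; rewrite z0 C0 => h.
by have := B_ge0; lra.
Qed.

Let stop_le k z : stop k z -> C k (idx k z) <= c0 + 4 * B.
Proof.
move=> sz; have := stop_gt0 sz; case: k sz => // k [z0 _ /(_ k (leqnn _)) h] _.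
by have := C_step k z0; lra.
Qed.

Let index : countType := (nat * ({ffun 'I_n -> int} * int))%type.

Let stopped : set index := [set a | exists2 z, idx a.1 z = a.2 & stop a.1 z].

Let stopped_set : set X := \bigcup_(a in stopped) cell a.1 a.2.

Let stopped_setP z : stopped_set z <-> exists k, stop k z.
Proof.
split => [[[k j] [w /= wj sw] /cellP zj]|[k sz]].
  by exists k; apply: stop_idx sw; rewrite wj zj.
by exists (k, idx k z); [exists z|apply/cellP].
Qed.

Let not_stopped z : idx 0 z = j0 -> ~ stopped_set z ->
  forall k, C k (idx k z) <= c0 + 2 * B.
Proof.
move=> z0 nz k; rewrite leNgt; apply/negP => Ck; apply: nz; apply/stopped_setP.
pose P k := c0 + 2 * B < C k (idx k z).
have exP : exists k, P k by exists k.
exists (ex_minn exP); case: ex_minnP => l Pl lmin; split => // l' l'l.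
by rewrite leNgt; apply/negP => /lmin; rewrite leqNgt l'l.
Qed.

(* The index of a cell of the same column inside the lower part of the rectangle of
   the cell [j]. *)
Let low k (j : {ffun 'I_n -> int} * int) : {ffun 'I_n -> int} * int :=
  (j.1, Num.floor (j.2%:~R - (1 + gamma) * side k `^ p / tau k)).

Let low_time k j : time_lo k j - (1 + gamma) * side k `^ p - tau k < time_lo k (low k j) /\
  time_lo k (low k j) <= time_lo k j - (1 + gamma) * side k `^ p.
Proof.
rewrite /time_lo /low /=; set y := j.2%:~R - (1 + gamma) * side k `^ p / tau k.
have t1 := tau_gt0 k; have /andP[y1 y2] := Num.Theory.floor_itv y.
have yE : y * tau k = j.2%:~R * tau k - (1 + gamma) * side k `^ p.
  by rewrite /y mulrBl divfK// gt_eqF.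
have y1' : (Num.floor y)%:~R * tau k <= y * tau k by rewrite ler_pM2r.
have y2' : y * tau k < (Num.floor y)%:~R * tau k + tau k.
  by rewrite -[X in _ + X]mul1r -mulrDl ltr_pM2r// -(intrD _ _ 1).
by rewrite yE in y1' y2'; split; lra.
Qed.

(** The lower part has height [(1 - gamma) * side k ^ p], at least twice [tau k], which leaves room
    for the rounding down in [low]. *)
Let low_lower k j : cell k (low k j) `<=` lower (ctr k j) (ctime k j) (side k).
Proof.
move=> z [zx zt]; split.
  move=> i; have := zx i; rewrite !in_itv/= /ctr /space_lo/= => /andP[? ?].
  by apply/andP; split; lra.
move: zt; rewrite !in_itv/= /ctime => /andP[z1 z2].
have [h1 h2] := low_time k j; have := tau_le k; rewrite /top_ratio => h3.
by apply/andP; split; lra.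
Qed.

(** A column above the cell, long enough to reach from a lowered cell back to the stopped cell it
    comes from: the latter ends at most [2 * side k ^ p] after the start of the former. *)
Let star k (j : {ffun 'I_n -> int} * int) : set X := cbox xs tm true true
  (space_lo k j) (fun i => space_lo k j i + 2 * side k)
  true true (time_lo k j) (time_lo k j + tau k + 2 * side k `^ p).

(** By [tau_ge] the extra height [2 * side k ^ p] of a star is at most [4 / top_ratio] cell
    heights. *)
Let A : R := 1 + 4 / top_ratio.

Let A_gt1 : 1 < A.
Proof. by rewrite /A ltrDl divr_gt0. Qed.

Let measure_star k j : (mu (star k j) <= A%:E * mu (cell k j))%E.
Proof.
rewrite measure_cell measure_cbox; last 2 first.
- by move=> i; rewrite lerDl ltW.
- by rewrite -addrA lerDl ltW// addr_gt0// mulr_gt0.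
rewrite (eq_bigr (fun=> 2 * side k)); last by move=> i _; ring.
rewrite prodr_const card_ord -EFinM lee_fin [leRHS]mulrCA ler_pM2l ?exprn_gt0//.
rewrite /A [leLHS](_ : _ = tau k + 2 * side k `^ p); last by ring.
rewrite [leRHS]mulrDl mul1r lerD2l [leRHS]mulrAC ler_pdivlMr//.
have := tau_ge k; lra.
Qed.

Let lowered : set index := [set a | exists2 z, stop a.1 z & low a.1 (idx a.1 z) = a.2].

(** A smaller level means a larger cell. The lowered cells that meet no larger one are pairwise
    disjoint. *)
Let maximal_lowered : set index := [set a | lowered a /\
  forall b, lowered b -> (b.1 < a.1)%N -> cell a.1 a.2 `&` cell b.1 b.2 = set0].

Let cell_nonempty k j : cell k j !=set0.
Proof.
apply/set0P/negP => /eqP c0'.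
have := measure_cell k j; rewrite c0' measure0 => -[] /eqP.
by rewrite lt_eqF// mulr_gt0// exprn_gt0.
Qed.

Let trivIset_maximal (F : index -> set X) :
  trivIset maximal_lowered (fun a => cell a.1 a.2 `&` F a).
Proof.
move=> a b [la ma] [lb mb] [z [[za _] [zb _]]].
have [ab|ba|ab] := ltngtP a.1 b.1.
- by have /seteqP[/(_ z) + _] := mb _ la ab; case.
- by have /seteqP[/(_ z) + _] := ma _ lb ba; case.
- case: a b ab {la ma lb mb} za zb => a1 a2 [b1 b2] /= <-.
  by move=> /cellP <- /cellP <-.
Qed.

(** Take a point [w] of the lowered cell of [z] and the least level at which the cell of [w] is
    lowered. That cell is maximal and contains the lowered cell of [z], so its star reaches [z]. *)
Let stopped_star : stopped_set `<=` \bigcup_(a in maximal_lowered) star a.1 a.2.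
Proof.
move=> z /stopped_setP[k sz].
have [w wlow] := cell_nonempty k (low k (idx k z)).
pose P l := (l <= k)%N && `[< lowered (l, idx l w) >].
have exP : exists l, P l.
  exists k; rewrite /P leqnn; apply/asboolP; exists z => //=.
  by apply/esym/cellP.
case: (ex_minnP exP) => l /andP[lk /asboolP lw] lmin.
exists (l, idx l w); first split => //.
  move=> [b1 b2] lb /= bl; rewrite -subset0 => v [/cellP vw /cellP vb].
  have : P b1.
    rewrite /P (leq_trans (ltnW bl) lk); apply/asboolP.
    by rewrite -(idx_nested (ltnW bl) vw) vb.
  by move/lmin; rewrite leqNgt bl.
have /cellP wE := wlow.
have [zx zt] : cell k (idx k z) z by apply/cellP.
split.
  move=> i; have : cell l (idx l z) z by apply/cellP.
  move=> [/(_ i) + _]; rewrite /space_lo /=.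
  suff -> : (idx l z).1 i = (idx l w).1 i by [].
  by apply: (space_nested lk); rewrite wE.
move: zt; rewrite !in_itv/= => /andP[z1 z2].
have [h1 h2] := low_time k (idx k z); have [h3 h4] := time_refine w lk.
rewrite wE in h3 h4; have := tau_le k; rewrite /top_ratio => h5.
have h6 : side k `^ p <= side l `^ p.
  apply: ge0_ler_powR; rewrite ?nnegrE ?(ltW (side_gt0 _))//.
    by rewrite ltW// (lt_trans _ p_gt1).
  by rewrite /side (ler_pM2l L_gt0) lef_pV2 ?posrE// ler_nat leq_exp2l.
have h7 : 0 < gamma * side k `^ p by rewrite mulr_gt0.
have := sidep_gt0 k; have := tau_gt0 k; move: z1 z2 h1 h2 h3 h4 h5 h6 h7.
move: (time_lo _ _) (time_lo _ _) (time_lo _ _) (tau k) (tau l) (_ `^ p) (_ `^ p).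
by move=> *; apply/andP; split; lra.
Qed.

Hypothesis s_small : 16 * (1 + 4 / top_ratio) * s <= 1.

Let s_le : 16 * s <= 1.
Proof.
apply: le_trans s_small; rewrite -[leRHS]mulrA ler_pM2l//.
apply: ler_peMl => //; exact: ltW A_gt1.
Qed.

(** A cell has at least a quarter of the measure of the upper or lower part of its rectangle, so an
    exceptional set there can fill at most half of a cell. *)
Let control_cell k j :
  (s%:E * ((2 * side k) ^+ n * ((1 - gamma) * side k `^ p))%:E <= 2^-1%:E * mu (cell k j))%E.
Proof.
rewrite measure_cell -!EFinM lee_fin [leLHS]mulrCA [leRHS]mulrCA ler_pM2l ?exprn_gt0//.
have h1 : (1 - gamma) * side k `^ p <= 4 * tau k.
  by have := tau_ge k; rewrite /top_ratio => ?; lra.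
apply: (le_trans (ler_wpM2l s_ge0 h1)); rewrite mulrA ler_pM2r//.
by have := s_le => ?; lra.
Qed.

Let U : set X := [set z | ((c0 + B)%:E < g z)%E].

Let measurable_cell k j : measurable (cell k j). Proof. exact: measurable_cbox. Qed.

Let low_rect k z : cell k (low k (idx k z)) `<=` rect_of k (idx k z).
Proof. by apply: subset_trans (@low_lower k (idx k z)) _; exact: lower_rect. Qed.

Let cell_rect k j : cell k j `<=` rect_of k j.
Proof.
apply: subset_trans (@cell_top k j) _.
by apply: subset_trans (@upper_rect _ _ _ _); [exact: top_upper|].
Qed.

(** The constant of a stopped cell exceeds [c0 + 2 * B], so [g] exceeds [c0 + B] on its lower part
    outside an exceptional set, which by [control_cell] takes at most half of the lowered cell. *)
Let low_heavy k z : stop k z ->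
  (mu (cell k (low k (idx k z))) <= 2%:E * mu (cell k (low k (idx k z)) `&` U))%E.
Proof.
move=> sz; have [z0 Cz _] := sz; set K := cell _ _.
have KQ : K `<=` Q by apply: subset_trans (@low_rect k z) _; exact: rect_Q.
have mKU : measurable (K `&` U) by apply: (measurable_gt osc) => //; exact: measurable_cell.
set W := lower (ctr k (idx k z)) (ctime k (idx k z)) (side k) `&`
  [set w | (g w < (C k (idx k z) - B)%:E)%E].
have mW : measurable W.
  apply: (measurable_lt osc); first exact: measurable_slab.
  by apply: subset_trans (rect_Q (k := k) z0); exact: lower_rect.
have W_le : (mu W <= 2^-1%:E * mu K)%E.
  apply: (le_trans (lower_control osc (side_gt0 k) (rect_Q (k := k) z0))).
  by rewrite measure_lower//; exact: control_cell.
have : (mu K <= mu (K `&` U) + mu W)%E.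
  apply: le_trans (measureU2 _ mKU mW).
  apply: le_measure; rewrite ?inE//; [exact: measurable_cell|exact: measurableU|].
  move=> w Kw; have [gw|gw] := ltP (c0 + B)%:E (g w); first by left.
  right; split; first exact: low_lower.
  by apply: le_lt_trans gw _; rewrite lte_fin; lra.
have KUK : (mu (K `&` U) <= mu K)%E by apply: le_measure; rewrite ?inE//; exact: measurable_cell.
move: KUK W_le; rewrite [mu K]measure_cell.
case: (mu W) (measure_ge0 mu W) => [w| |]//; case: (mu _) (measure_ge0 mu (K `&` U)) => [v| |]//.
by rewrite -!EFinM -EFinD !lee_fin => *; lra.
Qed.

Let measurable_stopped : measurable stopped_set.
Proof. by apply: measurable_bigcup_count => a _; exact: measurable_cell. Qed.

(** Stars cost a factor [A] and the passage to [U] a factor 2. Upper control in the original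
    rectangle makes [U] a fraction [s] of [upper], which has twice the measure of [top]. *)
Let measure_stopped : (mu stopped_set <= (4 * A * s)%:E * mu (top x t L))%E.
Proof.
have A0 : 0 <= A by rewrite ltW// (lt_trans _ A_gt1).
have lowQ a : lowered a -> cell a.1 a.2 `<=` upper x t L.
  case: a => k j [z sz /= <-]; have := stop_gt0 sz.
  case: k sz => // k sz _; apply: subset_trans (@low_rect k.+1 z) _.
  by apply: rect_subS; case: sz.
have mUU : measurable (upper x t L `&` U).
  apply: (measurable_gt osc); first exact: measurable_slab.
  by apply: subset_trans rectQ; exact: upper_rect.
have mF a : maximal_lowered a -> measurable (cell a.1 a.2 `&` U).
  move=> [la _]; apply: (measurable_gt osc); first exact: measurable_cell.
  apply: subset_trans (lowQ _ la) _; apply: subset_trans rectQ; exact: upper_rect.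
apply: (@le_trans _ _ (mu (\bigcup_(a in maximal_lowered) star a.1 a.2))).
  apply: le_measure; rewrite ?inE.
  - exact: measurable_stopped.
  - by apply: measurable_bigcup_count => a _; exact: measurable_cbox.
  - exact: stopped_star.
apply: (@le_trans _ _ ((2 * A)%:E *
    mu (\bigcup_(a in maximal_lowered) (cell a.1 a.2 `&` U)))%E).
  apply: le_measure_bigcup.
  - by rewrite mulr_ge0.
  - by move=> a _; exact: measurable_cbox.
  - exact: mF.
  - exact: (@trivIset_maximal (fun=> U)).
  - move=> [k j] [[z sz /= <-] _]; apply: (le_trans (measure_star _ _)).
    by rewrite [2 * A]mulrC EFinM -muleA lee_pmul2l ?lte_fin ?(lt_trans _ A_gt1)// low_heavy.
apply: (@le_trans _ _ ((2 * A)%:E * mu (upper x t L `&` U))%E).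
  rewrite lee_wpmul2l ?lee_fin ?mulr_ge0//; apply: le_measure; rewrite ?inE//.
    by apply: measurable_bigcup_count => a; exact: mF.
  by move=> w [a [la _] [aw Uw]]; split => //; exact: lowQ aw.
apply: (@le_trans _ _ ((2 * A)%:E * (s%:E * mu (upper x t L)))%E).
  by rewrite lee_wpmul2l ?lee_fin ?mulr_ge0//; exact: (upper_control osc).
rewrite measure_upper// measure_top// -!EFinM lee_fin /top_ratio.
by rewrite le_eqVlt; apply/orP; left; apply/eqP; field.
Qed.

Hypothesis outer_coord : forall (E : set X) (e : R), (mu E < +oo)%E -> 0 < e ->
  exists G, [/\ E `<=` G, measurable G, <<s coord_halfspaces xs tm >> G &
    (mu G <= mu E + e%:E)%E].

Let side_small y : 0 < y -> exists k, 2 * side k <= y.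
Proof.
move=> y0; exists (Num.truncn (2 * L / y)); set k := Num.truncn _.
rewrite /side mulrA ler_pdivrMr// [leRHS]mulrC -ler_pdivrMr//.
apply: (le_trans (ltW (Num.Theory.truncnS_gt _))); rewrite -/k ler_nat.
by apply: leq_trans (ltn_expl k m_ge2) _.
Qed.

Let tau_small y : 0 < y -> exists k, tau k <= y.
Proof.
move=> y0; exists (Num.truncn (top_ratio * L `^ p / y)); set k := Num.truncn _.
rewrite /tau ler_pdivrMr// [leRHS]mulrC -ler_pdivrMr//.
apply: (le_trans (ltW (Num.Theory.truncnS_gt _))); rewrite -/k.
have [h _] := nslices_bounds k; apply: le_trans h.
apply: le_trans (powR_nat_expr_ge k m_gt0 (ltW p_gt1)); rewrite ler_nat.
by apply: leq_trans (ltn_expl k m_ge2) _.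
Qed.

(** A half-space open at [y] is exhausted by the level-[k] cells that end at or before [y], since
    the cells shrink to points. *)
Let halfspace_cells H : coord_halfspaces xs tm H -> exists F : (set X)^nat,
  H = \bigcup_k F k /\ forall k z w, idx k z = idx k w -> F k z -> F k w.
Proof.
move=> [[i [y ->]]|[y ->]].
  exists (fun k => [set z | space_lo k (idx k z) i + 2 * side k <= y]); split.
    apply/seteqP; split => [z /= zy|z [k _ /=]].
      have [k ky] := @side_small (y - xs z i) (etrans (subr_gt0 _ _) zy).
      exists k => //=; have [/(_ i) + _] : cell k (idx k z) z by apply/cellP.
      by rewrite in_itv/= => /andP[? ?]; lra.
    have [/(_ i) + _] : cell k (idx k z) z by apply/cellP.
    by rewrite in_itv/= => /andP[_ h1] h2; exact: lt_le_trans h1 h2.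
  by move=> k z w zw /=; rewrite zw.
exists (fun k => [set z | time_lo k (idx k z) + tau k <= y]); split.
  apply/seteqP; split => [z /= zy|z [k _ /=]].
    have [k ky] := @tau_small (y - tm z) (etrans (subr_gt0 _ _) zy).
    exists k => //=; have [_ +] : cell k (idx k z) z by apply/cellP.
    by rewrite in_itv/= => /andP[? ?]; lra.
  have [_ +] : cell k (idx k z) z by apply/cellP.
  by rewrite in_itv/= => /andP[_ h1] h2; exact: lt_le_trans h1 h2.
by move=> k z w zw /=; rewrite zw.
Qed.

Let rest : set X := (cell 0 j0 `&` [set z | ((c0 + 3 * B)%:E < g z)%E]) `\` stopped_set.

Let cell0Q : cell 0 j0 `<=` Q.
Proof.
by apply: subset_trans (@cell_rect 0 j0) _; rewrite /rect_of ctr0 ctime0 side0.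
Qed.

Let measurable_rest : measurable rest.
Proof. by apply: measurableD => //; apply: (measurable_gt osc) => //; exact: measurable_cell. Qed.

(** Every cell around a point of [rest] has constant at most [c0 + 2 * B]. Upper control then lets
    the values above [c0 + 3 * B] fill at most half of it, and the density lemma applies. *)
Let rest_null : mu rest = 0%E.
Proof.
have rest_fin : (mu rest < +oo)%E.
  apply: (@le_lt_trans _ _ (mu (cell 0 j0))); last by rewrite measure_cell ltry.
  by apply: le_measure; rewrite ?inE// => z [[]].
apply: (@null_set_of_cells _ _ _ _ mu idx _ _ (cell 0 j0) _ _ (coord_halfspaces xs tm)) => //.
- by move=> k j; rewrite cell_preimage.
- by move=> k z w; exact: idx_nested.
- by rewrite measure_cell ltry.
- by move=> z [[]].
- by move=> e e0; exact: outer_coord.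
- move=> k j; rewrite cell_preimage.
  have [->|/set0P[z [[[z0 _] nz] /cellP zj]]] := eqVneq (rest `&` cell k j) set0.
    by rewrite measure0 mule_ge0// lee_fin.
  move/cellP : z0 => z0; have := not_stopped z0 nz k; rewrite zj => Ck.
  have rQ : rect_of k j `<=` Q by rewrite -zj; exact: rect_Q.
  have cellk0 : cell k j `<=` cell 0 j0.
    by move=> w /cellP wj; apply/cellP; rewrite -z0; apply: (idx_nested (leq0n k)); rewrite wj.
  rewrite (_ : cell 0 j0 `&` cell k j = cell k j); last exact/setIidPr.
  apply: (@le_trans _ _ (s%:E * mu (upper (ctr k j) (ctime k j) (side k)))%E).
    apply: le_trans (upper_control osc (side_gt0 k) rQ).
    apply: le_measure; rewrite ?inE//; first exact: measurableI.
      apply: (measurable_gt osc); first exact: measurable_slab.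
      by apply: subset_trans rQ; exact: upper_rect.
    move=> w [[[_ gw] _] /cell_top/top_upper wU]; split; first exact: wU.
    by apply: le_lt_trans gw; rewrite lee_fin -/(C k j); lra.
  by rewrite measure_upper//; exact: control_cell.
Qed.

(** The top is closed in space and the cell half-open; equal measures show that the missing faces
    are null. *)
Let top_cell0 : mu (top x t L `\` cell 0 j0) = 0%E.
Proof.
have toplt : (mu (top x t L) < +oo)%E by rewrite measure_top ?ltry.
have c0top : cell 0 j0 `<=` top x t L by have := @cell_top 0 j0; rewrite ctr0 ctime0 side0.
rewrite measureD; [|exact: measurable_slab|exact: measurable_cell|exact: toplt].
rewrite (_ : top x t L `&` _ = cell 0 j0); last exact/setIidPr.
by rewrite [X in (X - _)%E]measure_top// [X in (_ - X)%E]measure_cell side0 tau0 subee.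
Qed.

(** Almost every point of the level set lies in a stopped cell, whose constant is at most
    [c0 + 4 * B], so the assumption applies at the top of its rectangle. That top is at most twice
    the cell, and [measure_stopped] bounds the total by [8 * A * s * e], at most [e / 2] by
    [s_small]. *)
Lemma decay_step (lam e : R) : 0 <= lam -> 0 <= e ->
  (forall x' t' L', 0 < L' -> rect x' t' L' `<=` Q ->
    (mu (top x' t' L' `&` [set z | ((c x' t' L' + lam)%:E < g z)%E]) <=
      e%:E * mu (top x' t' L'))%E) ->
  (mu (top x t L `&` [set z | ((c x t L + (4 * B + lam))%:E < g z)%E]) <=
    (e / 2)%:E * mu (top x t L))%E.
Proof.
move=> lam0 e0 IH; rewrite -/c0.
have topQ x' t' L' : 0 < L' -> rect x' t' L' `<=` Q -> top x' t' L' `<=` Q.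
  move=> L'0 RQ; apply: subset_trans RQ; apply: subset_trans (@upper_rect _ _ _ L'0).
  exact: top_upper.
have stoppedQ a : stopped a -> rect_of a.1 a.2 `<=` Q.
  by case: a => k j [z /= <- [z0 _ _]]; exact: rect_Q.
pose F (a : index) := cell a.1 a.2 `&` [set z | ((C a.1 a.2 + lam)%:E < g z)%E].
have mF a : stopped a -> measurable (F a).
  move=> sa; apply: (measurable_gt osc) => //; apply: subset_trans (stoppedQ _ sa).
  exact: cell_rect.
have F_le : (mu (\bigcup_(a in stopped) F a) <= (2 * e)%:E * mu stopped_set)%E.
  apply: le_measure_bigcup => //; first by rewrite mulr_ge0.
    (* Stopped cells with a common point have the same level: the coarser one would have stopped the
       finer one earlier. *)
    move=> a b [z za sz] [w wb sw] [v [/cellP va /cellP vb]].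
    have [ab|ba|ab] := ltngtP a.1 b.1.
    - have [_ Ca _] := sz; have [_ _ /(_ _ ab)] := sw.
      have -> : idx a.1 w = idx a.1 z.
        by rewrite za -va; apply: (idx_nested (ltnW ab)); rewrite vb wb.
      by rewrite leNgt Ca.
    - have [_ Cb _] := sw; have [_ _ /(_ _ ba)] := sz.
      have -> : idx b.1 z = idx b.1 w.
        by rewrite wb -vb; apply: (idx_nested (ltnW ba)); rewrite va za.
      by rewrite leNgt Cb.
    - by case: a b ab {sz sw za wb} va vb => a1 a2 [b1 b2] /= <- <- <-.
  move=> a sa; apply: (@le_trans _ _ (e%:E * mu (top (ctr a.1 a.2) (ctime a.1 a.2) (side a.1)))%E).
    apply: le_trans (IH _ _ _ (side_gt0 a.1) (stoppedQ _ sa)).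
    apply: le_measure; rewrite ?inE//; first exact: mF.
      apply: (measurable_gt osc); first exact: measurable_slab.
      by apply: topQ => //; exact: stoppedQ.
    by move=> z [/cell_top ? ?]; split.
  rewrite measure_top// measure_cell -!EFinM lee_fin [leLHS]mulrCA [leRHS]mulrCA.
  rewrite ler_pM2l ?exprn_gt0// [leRHS](_ : _ = e * (2 * tau a.1)); last by ring.
  by apply: ler_wpM2l => //; exact: tau_ge.
apply: (@le_trans _ _ (mu ((top x t L `\` cell 0 j0) `|` rest `|` \bigcup_(a in stopped) F a))).
  have mUF : measurable (\bigcup_(a in stopped) F a) by exact: measurable_bigcup_count.
  apply: le_measure; rewrite ?inE//.
    apply: (measurable_gt osc); first exact: measurable_slab.
    exact: topQ.
    apply: measurableU => //; apply: measurableU => //; apply: measurableD => //.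
    exact: measurable_slab.
  move=> z [tz gz]; have [zc|nzc] := pselect (cell 0 j0 z); last by left; left.
  have [zs|nzs] := pselect (stopped_set z); last first.
    left; right; split => //; split => //; apply: le_lt_trans gz.
    by have := B_ge0 => ?; rewrite lee_fin; lra.
  right; case: (zs) => a sa az; exists a => //; split => //.
  apply: le_lt_trans gz; rewrite lee_fin; case: a sa {az} => k j [w /= <-].
  by move=> /stop_le; lra.
apply: le_trans (measureU2 _ _ _) _.
- by apply: measurableU => //; apply: measurableD => //; exact: measurable_slab.
- exact: measurable_bigcup_count.
have N0 : mu ((top x t L `\` cell 0 j0) `|` rest) = 0%E.
  by rewrite measureU0//; apply: measurableD => //; exact: measurable_slab.
rewrite [X in (X + _)%E]N0 add0e; apply: (le_trans F_le).
apply: (@le_trans _ _ ((2 * e)%:E * ((4 * A * s)%:E * mu (top x t L)))%E).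
  by rewrite lee_wpmul2l ?lee_fin ?mulr_ge0//; exact: measure_stopped.
rewrite muleA -EFinM lee_wpmul2r// lee_fin.
rewrite [leLHS](_ : _ = (16 * A * s) * (e / 2)); last by field.
by rewrite ler_piMl// divr_ge0.
Qed.

End stopping_tree.

(** * Exponential decay at the tops of rectangles *)

Section decay.
Variable m : nat.
Hypotheses (m_ge2 : (2 <= m)%N) (m_large : 4 <= (1 - gamma) * m%:R).
Hypothesis s_link : s * ((m%:R) ^+ n * m%:R `^ p + 1) < 1.
Hypothesis s_small : 16 * (1 + 4 / top_ratio) * s <= 1.
Hypothesis outer_coord : forall (E : set X) (e : R), (mu E < +oo)%E -> 0 < e ->
  exists G, [/\ E `<=` G, measurable G, <<s coord_halfspaces xs tm >> G &
    (mu G <= mu E + e%:E)%E].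

Lemma exponential_decay (j : nat) x t L : 0 < L -> rect x t L `<=` Q ->
  (mu (top x t L `&` [set z | ((c x t L + 4 * B * j%:R)%:E < g z)%E]) <=
    (2^-1 ^+ j)%:E * mu (top x t L))%E.
Proof.
elim: j x t L => [|j IH] x t L L0 RQ.
  rewrite expr0 mul1e; apply: le_measure; rewrite ?inE//; last exact: measurable_slab.
  apply: (measurable_gt osc); first exact: measurable_slab.
  apply: subset_trans RQ; apply: subset_trans (@upper_rect _ _ _ L0); exact: top_upper.
have -> : 4 * B * j.+1%:R = 4 * B + 4 * B * j%:R by rewrite -natr1; ring.
have -> : 2^-1 ^+ j.+1 = 2^-1 ^+ j / 2 :> R by rewrite exprSr.
by apply: (decay_step m_ge2) => //; rewrite !mulr_ge0.
Qed.

End decay.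

(** * Chains of rectangles and covering of a part with another lag *)

Section chain.
Hypothesis s_chain : s * 2 ^+ n.+2 < 1.

(** The overlap [O] has sides at least [l] and height at least [(1 - gamma) / 2 * l ^ p], a fraction
    [2 ^ -(n + 1)] of either part. The further factor 2 in [s_chain] accounts for the two
    exceptional sets. *)
Lemma chain_step (x1 x2 : 'I_n -> R) (t1 t2 l : R) : 0 < l ->
  (forall i, `|x2 i - x1 i| <= l) ->
  (1 + gamma) * l `^ p <= t2 - t1 <= (3 + gamma) / 2 * l `^ p ->
  rect x1 t1 l `<=` Q -> rect x2 t2 l `<=` Q -> c x2 t2 l <= c x1 t1 l + 2 * B.
Proof.
move=> l0 x12 /andP[t12 t12'] R1 R2.
pose a i := Num.max (x1 i) (x2 i) - l.
pose b i := Num.min (x1 i) (x2 i) + l.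
have ab i : l <= b i - a i.
  by have := x12 i; rewrite ler_norml /a /b => /andP[? ?];
    case: (leP (x1 i) (x2 i)) => *; lra.
have lp0 : 0 < l `^ p by exact: powR_gt0.
have glp0 : 0 < (1 - gamma) * l `^ p by rewrite mulr_gt0// subr_gt0.
pose O := cbox xs tm true false a b false true (t2 - l `^ p) (t1 + l `^ p).
apply: (link (O := O)) => //.
- exact: measurable_cbox.
- move=> z [zx zt]; split.
    move=> i; have := zx i; rewrite !in_itv/= /a /b => /andP[].
    by case: (leP (x1 i) (x2 i)) => *; apply/andP; split; lra.
  by move: zt; rewrite !in_itv/= => /andP[? ?]; apply/andP; split; lra.
- move=> z [zx zt]; split.
    move=> i; have := zx i; rewrite !in_itv/= /a /b => /andP[].
    by case: (leP (x1 i) (x2 i)) => *; apply/andP; split; lra.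
  by move: zt; rewrite !in_itv/= => /andP[? ?]; apply/andP; split; lra.
rewrite measure_upper// measure_lower// measure_cbox; last 2 first.
- by move=> i; have := ab i; lra.
- lra.
rewrite -!EFinM -EFinD lte_fin.
apply: (@lt_le_trans _ _ (l ^+ n * ((1 - gamma) * l `^ p / 2))); last first.
  apply: ler_pM; [by rewrite exprn_ge0 ?ltW|by rewrite divr_ge0// ltW| |lra].
  rewrite -[X in l ^+ X]card_ord -prodr_const; apply: ler_prod => i _.
  by rewrite ltW//= ab.
rewrite [ltLHS](_ : _ = (s * 2 ^+ n.+2) * (l ^+ n * ((1 - gamma) * l `^ p / 2))).
  by rewrite gtr_pMl// mulr_gt0 ?exprn_gt0// divr_gt0.
by rewrite exprMn !exprS; field.
Qed.

Lemma chain (x y : 'I_n -> R) (t r l : R) (K : nat) : 0 < l -> (0 < K)%N ->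
  (forall i, `|y i - x i| <= K%:R * l) ->
  K%:R * (1 + gamma) * l `^ p <= r - t <= K%:R * ((3 + gamma) / 2) * l `^ p ->
  (forall a, 0 <= a <= 1 ->
    rect (fun i => x i + a * (y i - x i)) (t + a * (r - t)) l `<=` Q) ->
  c y r l <= c x t l + 2 * K%:R * B.
Proof.
move=> l0 K0 xy /andP[tr1 tr2] RQ; have K0' : 0 < K%:R :> R by rewrite ltr0n.
pose xk k : 'I_n -> R := fun i => x i + k%:R / K%:R * (y i - x i).
pose tk k : R := t + k%:R / K%:R * (r - t).
have RQk k : (k <= K)%N -> rect (xk k) (tk k) l `<=` Q.
  by move=> kK; apply: RQ; rewrite divr_ge0//= ler_pdivrMr// mul1r ler_nat.
have H k : (k <= K)%N -> c (xk k) (tk k) l <= c x t l + 2 * k%:R * B.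
  elim: k => [_|k IH kK].
    rewrite mulr0 mul0r addr0 /tk mul0r mul0r addr0.
    by rewrite (_ : xk 0%N = x)//; apply/funext => i; rewrite /xk mul0r mul0r addr0.
  have step : c (xk k.+1) (tk k.+1) l <= c (xk k) (tk k) l + 2 * B.
    apply: chain_step => //; last 2 first.
    - by apply: RQk; exact: ltnW.
    - exact: RQk.
    - move=> i; rewrite [X in `|X|](_ : _ = (y i - x i) / K%:R); last first.
        by rewrite /xk -natr1; field; rewrite gt_eqF.
      by rewrite normrM normfV [`|K%:R|]ger0_norm// ler_pdivrMr// mulrC.
    - have -> : tk k.+1 - tk k = (r - t) / K%:R.
        by rewrite /tk -natr1; field; rewrite gt_eqF.
      by rewrite ler_pdivlMr// ler_pdivrMr//; apply/andP; split; lra.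
  by apply: (le_trans step); have := IH (ltnW kK); rewrite -natr1 => ?; lra.
have := H K (leqnn _); rewrite /tk divff ?gt_eqF// mul1r addrC subrK.
by rewrite (_ : xk K = y)//; apply/funext => i; rewrite /xk divff ?gt_eqF//; ring.
Qed.

(** The interval allowed for [K] has length [D * (1 - gamma) / ((1 + gamma) * (3 + gamma))], and the
    denominator is below 8, so rounding its upper end down stays inside. *)
Lemma step_count (D : R) : 8 <= (1 - gamma) * D ->
  exists K : nat, K%:R * (1 + gamma) <= D <= K%:R * ((3 + gamma) / 2).
Proof.
have [g0 g1] := (gamma_gt0, gamma_lt1) => D8.
have D0 : 0 < D by rewrite -(pmulr_rgt0 _ (_ : 0 < 1 - gamma)); lra.
have g10 : 0 < 1 + gamma by lra.
exists (Num.truncn (D / (1 + gamma))); set k := Num.truncn _.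
have Dg : 0 <= D / (1 + gamma) by rewrite divr_ge0// ltW.
have /andP[] := Num.Theory.truncn_itv Dg.
rewrite -/k ler_pdivlMr// ltr_pdivrMr// -natr1 => k1 k2; rewrite k1/= leNgt.
apply/negP => Dk.
have h1 : 0 < (2 * D - k%:R * (3 + gamma)) * (1 + gamma) by rewrite mulr_gt0//; lra.
have h2 : 0 < ((k%:R + 1) * (1 + gamma) - D) * (3 + gamma) by rewrite mulr_gt0//; lra.
have h3 : 0 < (1 - gamma) * (5 + gamma) by rewrite mulr_gt0//; lra.
by move: h1 h2 h3 D8; move: (k%:R) => κ; nra.
Qed.

(** The pieces are open below and closed above. This suits times measured back from the end of a
    slab, as tops are closed at their start and open at their end. *)
Lemma subdivide (y h : R) (M : nat) : 0 < y -> y <= M%:R * h ->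
  exists j : 'I_M, j%:R * h < y <= (j%:R + 1) * h.
Proof.
move=> y0; elim: M => [|M IH]; first by rewrite mul0r leNgt y0.
have [/IH[j jy] _|My yM] := leP y (M%:R * h).
  by exists (widen_ord (leqnSn M) j).
by exists ord_max; rewrite My/= natr1.
Qed.

Lemma measure_cover_finType (T : finType) (E : set X) (A : T -> set X) (v : \bar R) :
  measurable E -> (forall a, measurable (A a)) -> E `<=` \bigcup_a A a ->
  (forall a, (mu (A a) <= v)%E) -> (mu E <= #|T|%:R%:E * v)%E.
Proof.
move=> mE mA EA Av.
have H (r : seq T) : (mu (\big[setU/set0]_(a <- r) A a) <= (size r)%:R%:E * v)%E.
  elim: r => [|a r IH]; first by rewrite big_nil measure0 mul0e.
  rewrite big_cons /= -add1n natrD EFinD ge0_muleDl ?lee_fin// mul1e.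
  have mU : measurable (\big[setU/set0]_(a <- r) A a) by exact: bigsetU_measurable.
  by apply: le_trans (measureU2 _ (mA a) mU) _; apply: leeD; [exact: Av|exact: IH].
rewrite cardE; apply: le_trans (H _); apply: le_measure; rewrite ?inE//.
  exact: bigsetU_measurable.
move=> z /EA[a _ Az]; rewrite -bigcup_seq; exists a => //=.
by rewrite mem_enum.
Qed.

(** [N] cells along each space axis, and enough layers of height [top_ratio * (L / N) ^ p] to
    exhaust a time span [L ^ p]. *)
Definition cover_index (N : nat) : finType :=
  ({ffun 'I_n -> 'I_N} * 'I_((Num.truncn (N%:R `^ p / top_ratio)).+1))%type.

(** The number of covering tops times a bound for the measure of one top relative to the part of lag
    [rho], obtained by enlarging the size [L / N] to [L]. *)
Definition cover_const (rho : R) (N : nat) : R :=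
  #|cover_index N|%:R * (top_ratio / (1 - rho)).

(** Each covering top of size [l = L / N] is reached from the concentric rectangle of size [l] by a
    chain of at most [N ^ p] links, which raises the constant by at most [2 * N ^ p * B]. *)
Lemma cover_decay (rho lam e : R) (N : nat) (x : 'I_n -> R) (t L : R) :
  0 < rho -> rho < 1 -> 2 * N%:R + 1 + 8 / (1 - gamma) <= rho * N%:R `^ p ->
  0 < L -> rect x t L `<=` Q -> 0 <= e ->
  (forall y r, rect y r (L / N%:R) `<=` Q ->
    (mu (top y r (L / N%:R) `&` [set z | ((c y r (L / N%:R) + lam)%:E < g z)%E])
      <= e%:E * mu (top y r (L / N%:R)))%E) ->
  (mu (slab x L false true (t + rho * L `^ p) (t + L `^ p) `&`
      [set z | ((c x t (L / N%:R) + 2 * N%:R `^ p * B + lam)%:E < g z)%E])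
    <= (e * cover_const rho N)%:E *
      mu (slab x L false true (t + rho * L `^ p) (t + L `^ p)))%E.
Proof.
move=> rho0 rho1 N_large L0 RQ e0; set l := L / N%:R => IH.
set E := slab x L _ _ _ _.
have g8 : 0 < 8 / (1 - gamma) by rewrite divr_gt0// subr_gt0.
have N0 : (0 < N)%N.
  case: N N_large {l IH} => // h; exfalso; move: h.
  by rewrite !mulr0n powR0 ?gt_eqF ?(lt_trans _ p_gt1)// !mulr0 => h; lra.
have N0' : 0 < N%:R :> R by rewrite ltr0n.
have l0 : 0 < l by rewrite divr_gt0.
have LE : L = N%:R * l by rewrite /l mulrC divfK// gt_eqF.
have lp0 : 0 < l `^ p by exact: powR_gt0.
have LpE : L `^ p = N%:R `^ p * l `^ p by rewrite LE powRM// ltW.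
have Np0 : 0 < N%:R `^ p :> R by exact: powR_gt0.
have Lp0 : 0 < L `^ p by exact: powR_gt0.
have th0 : 0 < top_ratio by rewrite divr_gt0// subr_gt0.
set h := top_ratio * l `^ p; have h0 : 0 < h by exact: mulr_gt0.
pose yw (w : {ffun 'I_n -> 'I_N}) i := x i + (2 * (w i)%:R + 1 - N%:R) * l.
pose rj (j : nat) := t + L `^ p - j%:R * h - l `^ p.
pose G := [set z | ((c x t l + 2 * N%:R `^ p * B + lam)%:E < g z)%E].
(* Layers that end at or before the start of the slab are replaced by the empty set; the centres of
   the others are late enough for a chain. *)
pose A (a : cover_index N) := if a.2%:R * h < (1 - rho) * L `^ p
  then top (yw a.1) (rj a.2) l `&` G else set0.
have yx w i : `|yw w i - x i| <= (N%:R - 1) * l.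
  rewrite /yw addrAC subrr add0r normrM (ger0_norm (ltW l0)) ler_pM2r// ler_norml.
  have wN : (w i)%:R + 1 <= N%:R :> R by rewrite natr1 ler_nat.
  have : 0 <= (w i)%:R :> R by [].
  by move: (_%:R) wN => u wN u0; apply/andP; split; lra.
(* The centre is later than [t + rho * L ^ p - l ^ p]; the summand [1] in [N_large] pays for the
   last term. *)
have rjt (j : nat) : j%:R * h < (1 - rho) * L `^ p ->
    (2 * N%:R + 8 / (1 - gamma)) * l `^ p <= rj j - t /\ rj j - t <= L `^ p - l `^ p.
  move=> jh; split.
    have := ler_wpM2r (ltW lp0) N_large; rewrite -mulrA -LpE /rj.
    by move: (8 / _) => q h1; lra.
  have : 0 <= j%:R * h by rewrite mulr_ge0// ltW.
  by rewrite /rj => ?; lra.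
have sub (j : nat) w a : j%:R * h < (1 - rho) * L `^ p -> 0 <= a <= 1 ->
    rect (fun i => x i + a * (yw w i - x i)) (t + a * (rj j - t)) l `<=` rect x t L.
  move=> /rjt[r1 r2] /andP[a0 a1]; have r0 : 0 <= rj j - t.
    by apply: le_trans r1; rewrite ltW// mulr_gt0// addr_gt0// mulr_gt0.
  have ar1 : a * (rj j - t) <= rj j - t by rewrite ler_piMl.
  have ar0 : 0 <= a * (rj j - t) by rewrite mulr_ge0.
  apply: slab_subset.
  - move=> i; have : `|a * (yw w i - x i)| <= (N%:R - 1) * l.
      by rewrite normrM (ger0_norm a0) (le_trans _ (yx w i))// ler_piMl.
    by rewrite ler_norml LE => /andP[? ?]; split; lra.
  - by right; split => //; lra.
  - by right; split => //; lra.
have linked (j : nat) w : j%:R * h < (1 - rho) * L `^ p ->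
    c (yw w) (rj j) l <= c x t l + 2 * N%:R `^ p * B.
  move=> jh; have [r1 r2] := rjt _ jh.
  pose D := (rj j - t) / l `^ p.
  have DE : D * l `^ p = rj j - t by rewrite divfK// gt_eqF.
  have D1 : 2 * N%:R + 8 / (1 - gamma) <= D by rewrite ler_pdivlMr.
  have D2 : D <= N%:R `^ p.
    by rewrite ler_pdivrMr// -LpE (le_trans r2)// lerBlDr lerDl ltW.
  have [K /andP[K1 K2]] : exists K : nat, K%:R * (1 + gamma) <= D <= K%:R * ((3 + gamma) / 2).
    apply: step_count; rewrite -ler_pdivrMl ?subr_gt0// mulrC.
    by apply: le_trans D1; rewrite lerDr mulr_ge0// ltW.
  (* A link takes less time than [2 * l ^ p] and [D] is at least [2 * N], so there are enough links
     to cover the distance [(N - 1) * l] in space. *)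
  have KN : N%:R <= K%:R :> R.
    have : K%:R * ((3 + gamma) / 2) <= K%:R * 2.
      by rewrite ler_wpM2l//; have := gamma_lt1 => ?; lra.
    by move=> ?; lra.
  have KD : K%:R <= D.
    by apply: le_trans K1; rewrite ler_peMr//; have := gamma_gt0 => ?; lra.
  apply: (@le_trans _ _ (c x t l + 2 * K%:R * B)); last first.
    by rewrite lerD2l ler_wpM2r// ler_pM2l// (le_trans KD).
  apply: chain => //.
  - by rewrite -(ltr_nat R) (lt_le_trans N0').
  - move=> i; apply: (le_trans (yx w i)); rewrite ler_pM2r//; lra.
  - by rewrite -DE; apply/andP; split; rewrite ler_pM2r.
  - by move=> a a01; apply: subset_trans RQ; exact: sub.
have subQ (j : nat) w : j%:R * h < (1 - rho) * L `^ p -> rect (yw w) (rj j) l `<=` Q.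
  move=> jh; apply: subset_trans RQ; have := sub j w 1 jh.
  rewrite mul1r addrC subrK ler01 lexx => /(_ isT).
  by rewrite (_ : (fun i => _) = yw w)//; apply/funext => i; rewrite mul1r addrC subrK.
have topQ y r : rect y r l `<=` Q -> top y r l `<=` Q.
  move=> RQ'; apply: subset_trans RQ'; apply: subset_trans (@upper_rect _ _ _ l0).
  exact: top_upper.
have rhoLp : 0 < rho * L `^ p by exact: mulr_gt0.
have rhoLp1 : 0 < (1 - rho) * L `^ p by rewrite mulr_gt0// subr_gt0.
have EQ : E `<=` Q.
  by apply: subset_trans RQ; apply: slab_subset => //; [left; lra|right].
have muE : mu E = ((2 * L) ^+ n * ((1 - rho) * L `^ p))%:E.
  by rewrite measure_slab; [congr (_ * _)%:E; ring|lra|lra].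
have mA a : measurable (A a).
  rewrite /A; case: ifPn => // jh; apply: (measurable_gt osc).
    exact: measurable_slab.
  by apply: topQ; exact: subQ.
have mEG : measurable (E `&` G).
  by apply: (measurable_gt osc) => //; exact: measurable_slab.
rewrite /cover_const [e * _]mulrCA EFinM -muleA.
apply: (measure_cover_finType (A := A)) => //.
- move=> z [[zx zt] Gz].
  have /choice[w Hw] : forall i, exists j : 'I_N,
      j%:R * (2 * l) <= xs z i - x i + L <= (j%:R + 1) * (2 * l).
    move=> i; have := zx i; rewrite in_itv/= => /andP[z1 z2].
    (* [subdivide] needs a positive offset, so the lower face of the closed cube is assigned to the
       first cell. *)
    have [y0|y0] := leP (xs z i - x i + L) 0.
      exists (Ordinal N0); rewrite mul0r add0r mul1r; apply/andP; split; lra.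
    have [|j /andP[/ltW j1 j2]] := @subdivide _ (2 * l) N y0.
      by rewrite mulrCA -LE; lra.
    by exists j; rewrite j1.
  move: zt; rewrite in_itv/= => /andP[zt1 zt2].
  have [||j /andP[j1 j2]] := @subdivide (t + L `^ p - tm z) h
      (Num.truncn (N%:R `^ p / top_ratio)).+1.
  + by rewrite subr_gt0.
  + apply: (@le_trans _ _ (L `^ p)); first by lra.
    rewrite LpE /h mulrA ler_pM2r// -ler_pdivrMr//.
    exact/ltW/Num.Theory.truncnS_gt.
  exists ([ffun i => w i], j) => //; rewrite /A /=.
  have -> : j%:R * h < (1 - rho) * L `^ p by lra.
  split => //; split.
    move=> i; have /andP[] := Hw i; rewrite /yw ffunE in_itv/= LE => *.
    by apply/andP; split; lra.
  by rewrite in_itv/= /rj -/h; apply/andP; split; lra.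
- move=> a; rewrite /A; case: ifPn => jh; last first.
    rewrite measure0 muE -EFinM lee_fin; apply: mulr_ge0.
      by rewrite mulr_ge0// ltW// divr_gt0// subr_gt0.
    by rewrite ltW// mulr_gt0// exprn_gt0// mulr_gt0.
  apply: (@le_trans _ _ (e%:E * mu (top (yw a.1) (rj a.2) l))%E).
    apply: le_trans (IH _ _ (subQ _ _ jh)); apply: le_measure; rewrite ?inE.
    + by have := mA a; rewrite /A jh.
    + apply: (measurable_gt osc); first exact: measurable_slab.
      by apply: topQ; exact: subQ.
    + move=> z [tz Gz]; split => //; apply: le_lt_trans Gz.
      by rewrite lee_fin lerD2r; exact: linked.
  rewrite measure_top// muE -!EFinM lee_fin -[leRHS]mulrA ler_wpM2l//.
  rewrite [leRHS](_ : _ = (2 * L) ^+ n * (top_ratio * L `^ p)); last first.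
    by field; rewrite gt_eqF// subr_gt0.
  have lL : l <= L by rewrite LE; apply: ler_peMl; [exact: ltW|rewrite ler1n].
  apply: ler_pM; [by rewrite exprn_ge0// ltW// mulr_gt0|exact: ltW| |].
    by apply: lerXn2r; rewrite ?nnegrE ?ler_pM2l// ltW// mulr_gt0.
  rewrite ler_pM2l//; apply: ge0_ler_powR; rewrite ?nnegrE ?(ltW l0) ?(ltW L0)//.
  by rewrite ltW// (lt_trans _ p_gt1).
Qed.

End chain.
End parabolic_geometry.

(** * Layer-cake and Chebyshev estimates *)

(** From [y <= M * expR (y / M)], where [M] is such that, after raising to the power [q], an
    increase of [y] by 4 gives exactly a factor [3 / 2]. This base is below 2, so decay by halves
    wins. *)
Lemma powR_geometric_bound (R : realType) (q b : R) : 0 < q -> 0 < b ->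
  exists2 C : R, 0 < C & forall j : nat, (b + 4 * j%:R) `^ q <= C * (3 / 2) ^+ j.
Proof.
move=> q0 b0; have l0 : 0 < ln (3 / 2 : R) by apply: ln_gt0; lra.
pose M : R := 4 * q / ln (3 / 2); have M0 : 0 < M by rewrite divr_gt0// mulr_gt0.
exists (M `^ q * expR (b / M * q)); first by rewrite mulr_gt0 ?powR_gt0 ?expR_gt0.
move=> j; set y := b + _; have y0 : 0 < y by rewrite ltr_wpDr// mulr_ge0.
have yM : y <= M * expR (y / M).
  by rewrite -ler_pdivrMl// mulrC (le_trans _ (expR_ge1Dx _))// lerDr.
have -> : M `^ q * expR (b / M * q) * (3 / 2) ^+ j = (M * expR (y / M)) `^ q.
  rewrite powRM ?expR_ge0 ?ltW// -expRM -mulrA; congr (_ * _).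
  have {1}-> : 3 / 2 = expR (ln (3 / 2)) :> R by rewrite lnK// posrE; lra.
  rewrite -expRM_natl -expRD; congr expR; rewrite /y /M; field.
  by rewrite !gt_eqF.
apply: ge0_ler_powR => //; rewrite ?nnegrE ?(ltW q0) ?(ltW y0)//.
by rewrite mulr_ge0 ?expR_ge0// ltW.
Qed.

Lemma eseries_geometric_le (R : realType) (A : R) : 0 <= A ->
  (\sum_(0 <= j <oo) (((3 / 4) ^+ j * A)%:E) <= (4 * A)%:E)%E.
Proof.
move=> A0; apply: lime_le.
  by apply: is_cvg_nneseries => j _ _; rewrite lee_fin mulr_ge0// exprn_ge0.
apply: nearW => k; rewrite sumEFin lee_fin -mulr_suml ler_wpM2r//.
have -> : \sum_(0 <= j < k) (3 / 4 : R) ^+ j = 4 * (1 - (3 / 4) ^+ k).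
  elim: k => [|k IH]; first by rewrite big_geq// expr0 subrr mulr0.
  by rewrite big_nat_recr//= IH exprS; field.
have : 0 <= (3 / 4 : R) ^+ k by rewrite exprn_ge0.
lra.
Qed.

Section layer_cake.
Context {d : measure_display} {X : measurableType d} {R : realType}.
Variable mu : {measure set X -> \bar R}.

(** Pointwise, [h ^ q] is at most [B ^ q * C] times one plus the sum of [(3 / 2) ^ j] over the level
    sets [S j] containing the point. Integration leaves a geometric series of ratio [3 / 4]. *)
Lemma layer_cake (q a A : R) : 0 < q -> 0 <= a -> 0 <= A -> exists2 D : R, 0 < D &
  forall (E : set X) (h : X -> \bar R) (B : R), measurable E -> 0 < B ->
    measurable_fun E h -> (forall z, E z -> (0 <= h z)%E) ->
    (mu E < +oo)%E -> (forall j : nat, (mu (E `&` [set z | ((a + 4 * j%:R) * B)%:E < h z]) <=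
      (2^-1 ^+ j * A)%:E * mu E)%E) ->
    (\int[mu]_(z in E) (h z `^ q) <= (D * B `^ q)%:E * mu E)%E.
Proof.
move=> q0 a0 A0.
have [C C0 HC] := @powR_geometric_bound R q (a + 4) q0 (ltr_wpDl a0 (ltr0n _ 4)).
exists (C * (1 + 4 * A)); first by rewrite mulr_gt0// ltr_pwDl// mulr_ge0.
move=> E h B mE B0 mh h0 Eoo tail.
pose S j := E `&` [set z | (((a + 4 * j%:R) * B)%:E < h z)%E].
have mS j : measurable (S j) by exact: emeasurable_fun_o_infty.
pose F (j : nat) z : \bar R := (((3 / 2) ^+ j)%:E * (\1_(S j) z)%:E)%E.
have F0 j z : (0 <= F j z)%E by rewrite mule_ge0 ?lee_fin ?exprn_ge0.
have mF j : measurable_fun E (F j).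
  apply: emeasurable_funM; first exact: measurable_cst.
  by apply/measurable_EFinP; exact: measurable_indic.
have intF j : (\int[mu]_(z in E) F j z <= ((3 / 4) ^+ j * A)%:E * mu E)%E.
  rewrite ge0_integralZl//; first last.
    by apply/measurable_EFinP; exact: measurable_indic.
  rewrite integral_indic// setIC setIA setIid.
  apply: (@le_trans _ _ (((3 / 2) ^+ j)%:E * ((2^-1 ^+ j * A)%:E * mu E))%E).
    by rewrite lee_wpmul2l ?lee_fin ?exprn_ge0.
  rewrite muleA -EFinM mulrA -exprMn.
  by rewrite (_ : 3 / 2 / 2 = 3 / 4 :> R)//; field.
have BC0 : 0 <= B `^ q * C by rewrite mulr_ge0 ?powR_ge0// ltW.
have pw z : E z -> (h z `^ q <= (B `^ q * C)%:E * (1 + \sum_(0 <= j <oo) F j z))%E.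
  move=> Ez.
  have Fk k : S k z -> (((3 / 2) ^+ k)%:E <= \sum_(0 <= j <oo) F j z)%E.
    move=> Skz; apply: le_trans (nneseries_lim_ge k.+1 _) => //.
    rewrite big_nat_recr//= [F k z]/F indicE mem_set// mule1 leeDr//.
    by apply: sume_ge0 => j _.
  have := h0 z Ez; case Eh : (h z) => [u| |]// u0.
  - rewrite poweR_EFin; rewrite lee_fin in u0.
    have [uB|Bu] := leP u (a * B).
      apply: (@le_trans _ _ (B `^ q * C)%:E).
        rewrite lee_fin; apply: (@le_trans _ _ (((a + 4) * B) `^ q)).
          apply: ge0_ler_powR; rewrite ?nnegrE ?(ltW q0)//.
            by rewrite mulr_ge0 ?addr_ge0// ltW.
          by apply: (le_trans uB); rewrite ler_pM2r//; lra.
        rewrite powRM ?addr_ge0 ?(ltW B0)// mulrC ler_wpM2l ?powR_ge0//.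
        by have := HC 0%N; rewrite mulr0 addr0 expr0 mulr1.
      rewrite -[leLHS]mule1 lee_wpmul2l ?lee_fin//.
      by rewrite leeDl// nneseries_ge0// => j _ _; exact: F0.
    have y0 : 0 < u / B - a by rewrite subr_gt0 ltr_pdivlMr.
    have [|j /andP[j1 j2]] := @subdivide _ (u / B - a) 4 (Num.truncn ((u / B - a) / 4)).+1 y0.
      by rewrite -ler_pdivrMr// ltW// Num.Theory.truncnS_gt.
    have uE : u = u / B * B by rewrite divfK// gt_eqF.
    apply: (@le_trans _ _ (B `^ q * C * (3 / 2) ^+ j)%:E).
      rewrite lee_fin; apply: (@le_trans _ _ (((a + 4 + 4 * j%:R) * B) `^ q)).
        apply: ge0_ler_powR; rewrite ?nnegrE ?(ltW q0)//.
          by rewrite mulr_ge0 ?addr_ge0 ?mulr_ge0// ltW.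
        by rewrite [leLHS]uE ler_pM2r//; lra.
      rewrite powRM ?addr_ge0 ?mulr_ge0 ?(ltW B0)// mulrC -mulrA ler_wpM2l ?powR_ge0//.
    rewrite EFinM lee_wpmul2l ?lee_fin//; apply: le_trans (leeDr _ _) => //; apply: Fk.
    by split => //; rewrite /= Eh lte_fin [ltRHS]uE ltr_pM2r//; lra.
  (* Where [h] is infinite the point lies in every [S k], so the sum is infinite too. *)
  - rewrite poweRyr ?gt_eqF//.
    suff -> : (\sum_(0 <= j <oo) F j z = +oo)%E.
      by rewrite addey// mulry gtr0_sg ?mul1e// mulr_gt0// powR_gt0.
    apply: eq_infty => r; have {}Fk k : (((3 / 2) ^+ k)%:E <= \sum_(0 <= j <oo) F j z)%E.
      by apply: Fk; split => //; rewrite /= Eh ltry.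
    have pk k : k%:R / 2 <= (3 / 2) ^+ k :> R.
      apply: (@le_trans _ _ (1 + k%:R / 2)); first by rewrite lerDr.
      elim: k => [|k IH]; first by rewrite mul0r addr0 expr0.
      have k0 : 0 <= k%:R :> R by [].
      by rewrite exprS -natr1; move: IH k0; move: (k%:R) (_ ^+ k) => ? ? *; lra.
    apply: le_trans (Fk (Num.truncn (2 * r)).+1); rewrite lee_fin.
    apply: le_trans (pk _); rewrite ler_pdivlMr// mulrC.
    exact/ltW/Num.Theory.truncnS_gt.
have mhq : measurable_fun E (fun z => h z `^ q)%E.
  exact: (measurableT_comp (measurable_poweR q)).
have mSF : measurable_fun E (fun z => \sum_(0 <= j <oo) F j z)%E.
  exact: ge0_emeasurable_sum.
have m1SF : measurable_fun E (fun z => 1 + \sum_(0 <= j <oo) F j z)%E.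
  exact: emeasurable_funD.
apply: (@le_trans _ _ (\int[mu]_(z in E) ((B `^ q * C)%:E * (1 + \sum_(0 <= j <oo) F j z)))%E).
  apply: ge0_le_integral => //.
  - by move=> z _; exact: poweR_ge0.
  - exact: emeasurable_funM.
rewrite ge0_integralZl//; last by move=> z _; rewrite adde_ge0// nneseries_ge0.
rewrite ge0_integralD//; last by move=> z _; rewrite nneseries_ge0.
rewrite integral_cst// mul1e integral_nneseries//.
have Efin : mu E = (fine (mu E))%:E by rewrite fineK// ge0_fin_numE.
set e := fine (mu E) in Efin; have e0 : 0 <= e by exact: fine_ge0.
apply: (@le_trans _ _ ((B `^ q * C)%:E * (e%:E + (4 * (A * e))%:E))%E).
  rewrite lee_wpmul2l ?lee_fin// leeD ?Efin//.
  apply: le_trans (eseries_geometric_le (mulr_ge0 A0 e0)).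
  apply: lee_nneseries => [j _ _|j _]; first exact: integral_ge0.
  by have := intF j; rewrite Efin -EFinM mulrA.
rewrite [in leRHS]Efin -EFinD -!EFinM lee_fin le_eqVlt; apply/orP; left; apply/eqP.
ring.
Qed.

End layer_cake.

Section chebyshev.
Context {d : measure_display} {X : measurableType d} {R : realType}.
Variable mu : {measure set X -> \bar R}.

Lemma chebyshev_powR (q K B : R) (E : set X) (h : X -> \bar R) :
  0 < q -> 0 < K -> 0 < B -> measurable E -> (mu E < +oo)%E ->
  measurable_fun E h -> (forall z, E z -> (0 <= h z)%E) ->
  (\int[mu]_(z in E) (h z `^ q) <= (B `^ q)%:E * mu E)%E ->
  (mu (E `&` [set z | ((K * B)%:E < h z)%E]) <= (K `^ (- q))%:E * mu E)%E.
Proof.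
move=> q0 K0 B0 mE Eoo mh h0 hB.
set S := _ `&` _; have mS : measurable S by exact: emeasurable_fun_o_infty.
have SE : S `<=` E by move=> z [].
have KB0 : 0 < K * B by exact: mulr_gt0.
have mhq : measurable_fun E (fun z => h z `^ q)%E.
  exact: (measurableT_comp (measurable_poweR q)).
have : (((K * B) `^ q)%:E * mu S <= (B `^ q)%:E * mu E)%E.
  apply: le_trans hB; rewrite -integral_cst//.
  apply: (@le_trans _ _ (\int[mu]_(z in S) (h z `^ q)))%E; last first.
    by apply: ge0_subset_integral => // z _; exact: poweR_ge0.
  apply: ge0_le_integral => //.
  - by move=> z _; rewrite lee_fin powR_ge0.
  - exact: measurable_funS mhq.
  - move=> z [Ez]; rewrite /cst/=; case: (h z) => [u| |]//.
      rewrite lte_fin poweR_EFin lee_fin => uKB; apply: ge0_ler_powR.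
      + exact: ltW.
      + by rewrite nnegrE ltW.
      + by rewrite nnegrE ltW// (lt_trans _ uKB).
      + exact: ltW.
    by rewrite poweRyr ?gt_eqF// leey.
have Soo : (mu S < +oo)%E by apply: le_lt_trans Eoo; apply: le_measure; rewrite ?inE.
rewrite powRN powRM ?(ltW K0) ?(ltW B0)//.
have : mu S \is a fin_num by rewrite ge0_fin_numE.
have : mu E \is a fin_num by rewrite ge0_fin_numE.
case: (mu S) => [a| |]//; case: (mu E) => [e| |]// _ _.
rewrite -!EFinM !lee_fin -mulrA mulrCA ler_pM2l ?powR_gt0//.
by rewrite ler_pdivlMl ?powR_gt0.
Qed.

End chebyshev.

(** * Abstract slabs as parts of parabolic rectangles, in both directions of time *)

Section one_sided_coordinates.
Context {R : realType} {n : nat}.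
Implicit Types (x : 'I_n -> R) (b : bool).

Definition sgn_time b (t : R) := if b then t else - t.

Lemma slab_spacetime b x L u v :
  slab (space_coord (n := n)) (time_coord b) x L false true u v =
  (cube (\row_i x i) L `*` (if b then `]u, v[%classic else `](- v), (- u)[%classic)
    : set (spacetime R n)).
Proof.
have cubeP (y : 'rV[R]_n) : cube (\row_i x i) L y <->
    forall i, y ord0 i \in `[(x i - L), (x i + L)].
  split=> yx i; have := yx i; rewrite in_itv/= mxE ler_norml => /andP[? ?];
    by apply/andP; split; lra.
apply/seteqP; case: b; split => z [zx zt]; split.
- exact/cubeP.
- exact: zt.
- exact/cubeP.
- exact: zt.
- exact/cubeP.
- by move: zt; rewrite /= !in_itv/= => /andP[? ?]; apply/andP; split; lra.
- exact/cubeP.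
- by move: zt; rewrite /= !in_itv/= => /andP[? ?]; apply/andP; split; lra.
Qed.

Lemma rect_spacetime b p x t L : rect space_coord (time_coord b) p x t L =
  prect p (\row_i x i) (sgn_time b t) L.
Proof.
rewrite /rect slab_spacetime; case: b => //; rewrite /prect /sgn_time.
by congr (_ `*` `]_, _[%classic); apply/funext => _; ring.
Qed.

Definition later b p gamma (y : 'rV[R]_n) t L : set (spacetime R n) :=
  if b then prect_up p gamma y t L else prect_lo p gamma y t L.

Lemma upper_spacetime b p gamma x t L : upper space_coord (time_coord b) p gamma x t L =
  later b p gamma (\row_i x i) (sgn_time b t) L.
Proof.
rewrite /upper slab_spacetime; case: b => //; rewrite /later /= /prect_up /prect_lo.
by congr (_ `*` `]_, _[%classic); rewrite /sgn_time; apply/funext => _; ring.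
Qed.

Lemma lower_spacetime b p gamma x t L : lower space_coord (time_coord b) p gamma x t L =
  later (~~ b) p gamma (\row_i x i) (sgn_time b t) L.
Proof.
rewrite /lower slab_spacetime; case: b => //; rewrite /later /= /prect_up /prect_lo.
by congr (_ `*` `]_, _[%classic); rewrite /sgn_time; apply/funext => _; ring.
Qed.

End one_sided_coordinates.

(** * Control of [f] on rectangles and its behaviour under time reversal *)

Section control.
Context {R : realType} {n : nat}.
Local Notation mu := (@lebesgue_st R n).
Variables (Q : set (spacetime R n)) (f : spacetime R n -> \bar R) (p : R).
Hypotheses (mQ : measurable Q) (mf : measurable_fun Q f) (p_gt1 : 1 < p).

Definition lag_bound (gamma B s : R) (x : 'rV[R]_n) (t L k : R) :=
  (mu (prect_up p gamma x t L `&` [set z | (k + B)%:E < f z]) <=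
    s%:E * mu (prect_up p gamma x t L))%E /\
  (mu (prect_lo p gamma x t L `&` [set z | f z < (k - B)%:E]) <=
    s%:E * mu (prect_lo p gamma x t L))%E.

Definition lag_control (gamma B s : R) (c : 'rV[R]_n -> R -> R -> R) :=
  forall x t L, 0 < L -> prect p x t L `<=` Q -> lag_bound gamma B s x t L (c x t L).

Definition sgn_fun (b : bool) : spacetime R n -> \bar R :=
  if b then f else (fun z => - f z)%E.

(** Under time reversal constants are read at the reflected centre and negated, which exchanges
    upper and lower control. *)
Definition sgn_const (b : bool) (c : 'rV[R]_n -> R -> R -> R) (x : 'I_n -> R) (t L : R) : R :=
  if b then c (\row_i x i) t L else - c (\row_i x i) (- t) L.

Lemma sgn_fun_gt b (a : R) : [set z | (a%:E < sgn_fun b z)%E] =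
  [set z | if b then (a%:E < f z)%E else (f z < (- a)%:E)%E].
Proof. by case: b => //; apply/seteqP; split=> z; rewrite /sgn_fun/= lteNr. Qed.

Lemma sgn_fun_lt b (a : R) : [set z | (sgn_fun b z < a%:E)%E] =
  [set z | if b then (f z < a%:E)%E else ((- a)%:E < f z)%E].
Proof. by case: b => //; apply/seteqP; split=> z; rewrite /sgn_fun/= lteNl. Qed.

Lemma measurable_levels E (a : R) : measurable E -> E `<=` Q ->
  measurable (E `&` [set z | (a%:E < f z)%E]) /\ measurable (E `&` [set z | (f z < a%:E)%E]).
Proof.
move=> mE EQ; have mfE : measurable_fun E f by exact: measurable_funS mf.
by split; [exact: emeasurable_fun_o_infty|exact: emeasurable_fun_infty_o].
Qed.

Lemma osc_control_of_lag b gamma B s c : lag_control gamma B s c ->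
  osc_control (@lebesgue_st R n) space_coord (time_coord b) p gamma Q (sgn_fun b) B s (sgn_const b c).
Proof.
move=> ctl; split.
- move=> E a mE EQ; rewrite sgn_fun_gt; have [h1 h2] := measurable_levels a mE EQ.
  by have [h3 h4] := measurable_levels (- a) mE EQ; case: b.
- move=> E a mE EQ; rewrite sgn_fun_lt; have [h1 h2] := measurable_levels a mE EQ.
  by have [h3 h4] := measurable_levels (- a) mE EQ; case: b.
- move=> x t L L0; rewrite rect_spacetime upper_spacetime => RQ.
  have [h1 h2] := ctl _ _ _ L0 RQ; rewrite sgn_fun_gt /sgn_const.
  by case: b h1 h2 {RQ} => //= h1 h2; rewrite opprD !opprK.
- move=> x t L L0; rewrite rect_spacetime lower_spacetime => RQ.
  have [h1 h2] := ctl _ _ _ L0 RQ; rewrite sgn_fun_lt /sgn_const.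
  by case: b h1 h2 {RQ} => //= h1 h2; rewrite opprD !opprK.
Qed.

Lemma lebesgue_st_part b gamma (x : 'rV[R]_n) t L : 0 < L -> gamma < 1 ->
  mu (later b p gamma x t L) = ((2 * L) ^+ n * ((1 - gamma) * L `^ p))%:E.
Proof.
move=> L0 g1.
have := measure_upper (mu := @lebesgue_st R n) (xs := space_coord) (tm := time_coord b)
   p (gamma := gamma) (lebesgue_st_cbox b) g1 (fun i => x ord0 i) (sgn_time b t) L0.
rewrite upper_spacetime /=.
rewrite (_ : \row_i x ord0 i = x); last by apply/rowP => i; rewrite mxE.
by rewrite /sgn_time; case: b => //; rewrite opprK.
Qed.

End control.

(** * Passage from the lag [gamma] to the lag [rho] *)

Section lag_transfer.
Context {R : realType} {n : nat}.
Local Notation mu := (@lebesgue_st R n).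
Variables (Q : set (spacetime R n)) (f : spacetime R n -> \bar R) (p : R).
Hypotheses (mQ : measurable Q) (mf : measurable_fun Q f) (p_gt1 : 1 < p).
Variables (gamma B s : R) (c : 'rV[R]_n -> R -> R -> R).
Hypotheses (gamma_gt0 : 0 < gamma) (gamma_lt1 : gamma < 1) (B_ge0 : 0 <= B) (s_ge0 : 0 <= s).
Hypothesis ctl : lag_control Q f p gamma B s c.
Hypothesis s_chain : s * 2 ^+ n.+2 < 1.
Variables (rho : R) (N : nat).
Hypotheses (rho_gt0 : 0 < rho) (rho_lt1 : rho < 1).
Hypothesis N_large : 2 * N%:R + 1 + 8 / (1 - gamma) <= rho * N%:R `^ p.

Definition deviation (b : bool) (k a : R) : set (spacetime R n) :=
  [set z | if b then ((k + a)%:E < f z)%E else (f z < (k - a)%:E)%E].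

(** The constant is that of the concentric rectangle of size [L / N] for both values of [b], so the
    upper and the lower bound hold around one common constant. *)
Lemma lag_cover b (lam e : R) x (t L : R) : 0 < L -> prect p x t L `<=` Q -> 0 <= e ->
  (forall y r, rect space_coord (time_coord b) p y r (L / N%:R) `<=` Q ->
    (mu (top space_coord (time_coord b) p gamma y r (L / N%:R) `&`
        [set z | ((sgn_const b c y r (L / N%:R) + lam)%:E < sgn_fun f b z)%E])
      <= e%:E * mu (top space_coord (time_coord b) p gamma y r (L / N%:R)))%E) ->
  (mu (later b p rho x t L `&` deviation b (c x t (L / N%:R)) (2 * N%:R `^ p * B + lam)) <=
    (e * cover_const (n := n) p gamma rho N)%:E * mu (later b p rho x t L))%E.
Proof.
move=> L0 RQ e0 IH; pose xf i := x ord0 i.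
have xE : \row_i xf i = x by apply/rowP => i; rewrite mxE.
have tE : sgn_time b (sgn_time b t) = t by rewrite /sgn_time; case: b {IH} => //; rewrite opprK.
have RQ' : rect space_coord (time_coord b) p xf (sgn_time b t) L `<=` Q.
  by rewrite rect_spacetime xE tE.
have := cover_decay (measurable_spacetime_cbox (n := n) b) (lebesgue_st_cbox (n := n) b)
  gamma_gt0 gamma_lt1 p_gt1 B_ge0 (osc_control_of_lag mQ mf b ctl) s_chain rho_gt0 rho_lt1
  N_large L0 RQ' e0 IH.
rewrite -/(upper space_coord (time_coord b) p rho xf (sgn_time b t) L) upper_spacetime xE tE.
suff -> : [set z | ((sgn_const b c xf (sgn_time b t) (L / N%:R) + 2 * N%:R `^ p * B + lam)%:E
    < sgn_fun f b z)%E] = deviation b (c x t (L / N%:R)) (2 * N%:R `^ p * B + lam) by [].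
rewrite sgn_fun_gt /sgn_const xE /deviation /sgn_time.
apply/seteqP; case: b {IH tE RQ'} => /=; rewrite ?opprK; split => z /=;
  by rewrite ?opprD ?opprK ?addrA.
Qed.

(** Upper control is used once, without iteration: the top is half of the upper part, hence the
    factor [2 * s]. This suffices for a median. *)
Lemma lag_change b x (t L : R) : 0 < L -> prect p x t L `<=` Q ->
  (mu (later b p rho x t L `&` deviation b (c x t (L / N%:R)) ((2 * N%:R `^ p + 1) * B)) <=
    (2 * s * cover_const (n := n) p gamma rho N)%:E * mu (later b p rho x t L))%E.
Proof.
move=> L0 RQ; rewrite mulrDl mul1r; apply: lag_cover => //; first by rewrite mulr_ge0.
have N0 : (0 < N)%N.
  case: N N_large => // h; exfalso; move: h.
  have g8 : 0 < 8 / (1 - gamma) by rewrite divr_gt0// subr_gt0.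
  by rewrite !mulr0n powR0 ?gt_eqF ?(lt_trans _ p_gt1)// !mulr0 => h; lra.
have l0 : 0 < L / N%:R by rewrite divr_gt0// ltr0n.
move=> y r RQ'; have osc := osc_control_of_lag mQ mf b ctl.
have mS := measurable_spacetime_cbox (R := R) (n := n) b.
have upQ : upper space_coord (time_coord b) p gamma y r (L / N%:R) `<=` Q.
  by apply: subset_trans RQ'; exact: upper_rect.
have tU : top space_coord (time_coord b) p gamma y r (L / N%:R) `<=`
    upper space_coord (time_coord b) p gamma y r (L / N%:R) by exact: top_upper.
apply: (@le_trans _ _ (s%:E * mu (upper space_coord (time_coord b) p gamma y r (L / N%:R)))%E).
  apply: le_trans (upper_control osc l0 RQ').
  apply: le_measure; rewrite ?inE.
  - by apply: (measurable_gt osc); [exact: measurable_slab|apply: subset_trans upQ; exact: tU].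
  - by apply: (measurable_gt osc); [exact: measurable_slab|exact: upQ].
  - by move=> z [/tU].
rewrite (measure_upper _ (lebesgue_st_cbox (n := n) b))//.
rewrite (measure_top _ (lebesgue_st_cbox (n := n) b))//.
rewrite -!EFinM lee_fin le_eqVlt; apply/orP; left; apply/eqP; rewrite /top_ratio.
by move: (_ ^+ n) (_ `^ p) => V P; field.
Qed.

Lemma lag_decay b (m j : nat) x (t L : R) : (2 <= m)%N -> 4 <= (1 - gamma) * m%:R ->
  s * ((m%:R) ^+ n * m%:R `^ p + 1) < 1 -> 16 * (1 + 4 / top_ratio gamma) * s <= 1 ->
  0 < L -> prect p x t L `<=` Q ->
  (mu (later b p rho x t L `&`
      deviation b (c x t (L / N%:R)) ((2 * N%:R `^ p + 4 * j%:R) * B)) <=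
    (2^-1 ^+ j * cover_const (n := n) p gamma rho N)%:E * mu (later b p rho x t L))%E.
Proof.
move=> m2 m_large s1 s2 L0 RQ; rewrite mulrDl (mulrAC 4); apply: lag_cover => //.
have N0 : (0 < N)%N.
  case: N N_large => // h; exfalso; move: h.
  have g8 : 0 < 8 / (1 - gamma) by rewrite divr_gt0// subr_gt0.
  by rewrite !mulr0n powR0 ?gt_eqF ?(lt_trans _ p_gt1)// !mulr0 => h; lra.
have l0 : 0 < L / N%:R by rewrite divr_gt0// ltr0n.
move=> y r RQ'; have osc := osc_control_of_lag mQ mf b ctl.
apply: (exponential_decay (measurable_spacetime_cbox (n := n) b) (lebesgue_st_cbox (n := n) b)
  gamma_gt0 gamma_lt1 p_gt1 B_ge0 s_ge0 osc m2 m_large s1 s2) => //.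
exact: lebesgue_st_outer.
Qed.

End lag_transfer.

(** * Medians and integral averages on a rectangle *)

Section rectangle_values.
Context {R : realType} {n : nat}.
Local Notation mu := (@lebesgue_st R n).
Variables (Q : set (spacetime R n)) (f : spacetime R n -> \bar R) (p : R).
Hypotheses (mQ : measurable Q) (mf : measurable_fun Q f) (p_gt1 : 1 < p).

Definition excess (b : bool) (k : R) : spacetime R n -> \bar R :=
  if b then ((fun w => f w - k%:E)^\+)%E else ((fun w => f w - k%:E)^\-)%E.

Lemma excess_ge0 b (k : R) z : (0 <= excess b k z)%E.
Proof. by rewrite /excess; case: b; rewrite ?funepos_ge0 ?funeneg_ge0. Qed.

Lemma measurable_excess b (k : R) E : measurable E -> E `<=` Q -> measurable_fun E (excess b k).
Proof.
move=> mE EQ; have mfE : measurable_fun E (fun w => f w - k%:E)%E.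
  by apply: emeasurable_funB; [exact: measurable_funS mf|exact: measurable_cst].
by rewrite /excess; case: b; [exact: measurable_funepos|exact: measurable_funeneg].
Qed.

Lemma excess_gt b (k a : R) : 0 <= a ->
  [set z | (a%:E < excess b k z)%E] = deviation f b k a.
Proof.
move=> a0; have a0' : (a%:E < 0)%E = false by rewrite lte_fin ltNge a0.
case: b; apply/seteqP; split => z; rewrite /excess /deviation /=.
- by rewrite funeposE lt_max a0' orbF EFinN lteBrDr// -EFinD addrC.
- by rewrite funeposE lt_max a0' orbF EFinN lteBrDr// -EFinD addrC.
- by rewrite funenegE lt_max a0' orbF lteNr EFinN lteBlDr// -EFinN -EFinD addrC.
- by rewrite funenegE lt_max a0' orbF lteNr EFinN lteBlDr// -EFinN -EFinD addrC.
Qed.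

Lemma measurable_later b (gamma : R) (x : 'rV[R]_n) (t L : R) : measurable (later b p gamma x t L).
Proof.
have := measurable_slab (measurable_spacetime_cbox b) (fun i => x ord0 i) L false true
  (sgn_time b t + gamma * L `^ p) (sgn_time b t + L `^ p).
rewrite -/(upper space_coord (time_coord b) p gamma _ (sgn_time b t) L) upper_spacetime.
rewrite (_ : \row_i x ord0 i = x); last by apply/rowP => i; rewrite mxE.
by rewrite /sgn_time; case: b => //; rewrite opprK.
Qed.

Lemma later_prect b (gamma : R) (x : 'rV[R]_n) (t L : R) : 0 < L -> 0 < gamma ->
  later b p gamma x t L `<=` prect p x t L.
Proof.
move=> L0 g0.
have : upper space_coord (time_coord b) p gamma (fun i => x ord0 i) (sgn_time b t) L `<=`
  rect space_coord (time_coord b) p (fun i => x ord0 i) (sgn_time b t) L by exact: upper_rect.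
rewrite upper_spacetime rect_spacetime.
rewrite (_ : \row_i x ord0 i = x); last by apply/rowP => i; rewrite mxE.
by rewrite /sgn_time; case: b => //; rewrite opprK.
Qed.

Lemma measure_later_pos b (gamma : R) (x : 'rV[R]_n) (t L : R) : 0 < L -> gamma < 1 ->
  (0 < mu (later b p gamma x t L))%E /\ (mu (later b p gamma x t L) < +oo)%E.
Proof.
move=> L0 g1; rewrite lebesgue_st_part// lte_fin ltry; split => //.
by rewrite !mulr_gt0// ?exprn_gt0 ?powR_gt0 ?subr_gt0// mulr_gt0.
Qed.

Lemma choose_constants (P : 'rV[R]_n -> R -> R -> R -> Prop) :
  (forall x t L, 0 < L -> prect p x t L `<=` Q -> exists k, P x t L k) ->
  exists c, forall x t L, 0 < L -> prect p x t L `<=` Q -> P x t L (c x t L).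
Proof.
move=> H.
have /choice[c Hc] : forall a : 'rV[R]_n * R * R, exists k,
    0 < a.2 -> prect p a.1.1 a.1.2 a.2 `<=` Q -> P a.1.1 a.1.2 a.2 k.
  move=> [[x t] L] /=; have [[L0 RQ]|no] := pselect (0 < L /\ prect p x t L `<=` Q).
    by have [k Pk] := H _ _ _ L0 RQ; exists k.
  (* The value 0 is a default for triples that give no admissible rectangle. *)
  by exists 0 => L0 RQ; exfalso; apply: no.
by exists (fun x t L => c (x, t, L)) => x t L; exact: (Hc (x, t, L)).
Qed.

Definition median_value (gamma s : R) x t L : \bar R :=
  ereal_inf (range (fun k : R =>
    max_median s (excess true k) (later true p gamma x t L) +
    max_median s (excess false k) (later false p gamma x t L)))%E.

Definition integral_value (rho q : R) x t L : \bar R :=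
  ereal_inf (range (fun k : R =>
    (average (later true p rho x t L) (fun z => excess true k z `^ q) +
     average (later false p rho x t L) (fun z => excess false k z `^ q)) `^ q^-1))%E.

(** At a negative level the superlevel set is the whole part, whose measure is not less than [s]
    times itself since [s <= 1]. *)
Lemma max_median_ge0 b (gamma s k : R) x (t L : R) : 0 < L -> gamma < 1 -> 0 < s <= 1 ->
  (0 <= max_median s (excess b k) (later b p gamma x t L))%E.
Proof.
move=> L0 g1 /andP[s0 s1]; apply: le_ereal_inf_tmp => _ [a /= Ha <-].
rewrite leNgt lte_fin; apply/negP => a0; move: Ha; apply/negP; rewrite -leNgt.
rewrite (_ : [set z | _] = later b p gamma x t L); last first.
  apply/seteqP; split => [z []//|z zl]; split => //.
  by apply: lt_le_trans (excess_ge0 b k z); rewrite lte_fin.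
have [E0 Eoo] := measure_later_pos b x t L0 g1.
by rewrite -[leRHS]mul1e lee_wpmul2r ?lee_fin// ltW.
Qed.

Lemma control_of_median (gamma s B : R) : 0 < gamma -> gamma < 1 -> 0 < s <= 1 -> 0 < B ->
  (forall x t L, 0 < L -> prect p x t L `<=` Q -> (median_value gamma s x t L < B%:E)%E) ->
  exists c, lag_control Q f p gamma B s c.
Proof.
move=> g0 g1 s01 B0 H.
apply: (choose_constants (P := lag_bound f p gamma B s)) => x t L L0 RQ.
have [_ [k _ <-] kB] := ereal_inf_lt (H _ _ _ L0 RQ); exists k.
suff main b : (mu (later b p gamma x t L `&` deviation f b k B) <=
    s%:E * mu (later b p gamma x t L))%E by split; [exact: (main true)|exact: (main false)].
have mB : (max_median s (excess b k) (later b p gamma x t L) < B%:E)%E.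
  apply: le_lt_trans kB; have := max_median_ge0 true k x t L0 g1 s01.
  by have := max_median_ge0 false k x t L0 g1 s01; case: b => h1 h2; [rewrite leeDl|rewrite leeDr].
have [_ [a /= Ha <-] aB] := ereal_inf_lt mB.
have lQ : later b p gamma x t L `<=` Q by apply: subset_trans RQ; exact: later_prect.
have mE : measurable_fun (later b p gamma x t L) (excess b k).
  by apply: measurable_excess => //; exact: measurable_later.
apply: (le_trans _ (ltW Ha)); rewrite -(excess_gt b k (ltW B0)).
have mS (r : R) : measurable (later b p gamma x t L `&` [set z | (r%:E < excess b k z)%E]).
  exact: (emeasurable_fun_o_infty (measurable_later b gamma x t L) mE).
apply: (@le_trans _ _ (mu (later b p gamma x t L `&` [set z | (a%:E < excess b k z)%E]))) => //.
by apply: le_measure; rewrite ?inE// => z [zl /= Bz]; split => //; exact: lt_trans aB Bz.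
Qed.

Lemma median_of_control (gamma s k M : R) x (t L : R) : 0 <= M -> 0 < L ->
  (forall b, (mu (later b p gamma x t L `&` deviation f b k M) <
    s%:E * mu (later b p gamma x t L))%E) ->
  (median_value gamma s x t L <= (2 * M)%:E)%E.
Proof.
move=> M0 L0 H; have -> : (2 * M)%:E = (M%:E + M%:E)%E by rewrite -EFinD; congr EFin; ring.
apply: le_trans (ereal_inf_lbound _) _; first by exists k.
have med b : (max_median s (excess b k) (later b p gamma x t L) <= M%:E)%E.
  apply: ereal_inf_lbound; exists M => //=; have := H b.
  by rewrite -excess_gt.
exact: leeD (med true) (med false).
Qed.

Lemma averageE b (rho : R) (x : 'rV[R]_n) (t L : R) (h : spacetime R n -> \bar R) (a : R) :
  0 < L -> rho < 1 ->
  (average (later b p rho x t L) h <= a%:E)%E =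
  (\int[mu]_(z in later b p rho x t L) h z <= a%:E * mu (later b p rho x t L))%E.
Proof.
move=> L0 r1; have [E0 Eoo] := measure_later_pos b x t L0 r1.
rewrite /average; have Efin : mu (later b p rho x t L) \is a fin_num by rewrite ge0_fin_numE.
move: E0 Eoo Efin; case: (mu _) => [e| |]// + _ _; rewrite lte_fin => e0.
by rewrite lee_pdivrMl// muleC.
Qed.

(** Chebyshev's inequality with threshold factor [K = s ^ (- 1 / q)], for which the exceptional
    fraction [K ^ (- q)] equals [s]. *)
Lemma control_of_integral (rho q s B : R) : 0 < rho -> rho < 1 -> 0 < q -> 0 < s -> 0 < B ->
  (forall x t L, 0 < L -> prect p x t L `<=` Q -> (integral_value rho q x t L < B%:E)%E) ->
  exists c, lag_control Q f p rho (s `^ (- q^-1) * B) s c.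
Proof.
move=> r0 r1 q0 s0 B0 H.
apply: (choose_constants (P := lag_bound f p rho (s `^ (- q^-1) * B) s)) => x t L L0 RQ.
have [_ [k _ <-] kB] := ereal_inf_lt (H _ _ _ L0 RQ); exists k.
suff main b : (mu (later b p rho x t L `&` deviation f b k (s `^ (- q^-1) * B)) <=
    s%:E * mu (later b p rho x t L))%E by split; [exact: (main true)|exact: (main false)].
have av0 b' : (0 <= average (later b' p rho x t L) (fun z => excess b' k z `^ q))%E.
  rewrite mule_ge0 ?lee_fin ?invr_ge0 ?fine_ge0 ?measure_ge0//.
  by apply: integral_ge0 => z _; exact: poweR_ge0.
have sumB : (average (later true p rho x t L) (fun z => excess true k z `^ q) +
     average (later false p rho x t L) (fun z => excess false k z `^ q) <= (B `^ q)%:E)%E.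
  rewrite -poweR_EFin; move: kB; set S := (_ + _)%E => kB.
  have S0 : (0 <= S)%E by exact: adde_ge0 (av0 true) (av0 false).
  have -> : S = ((S `^ q^-1) `^ q)%E.
    by rewrite -poweRrM mulVf ?gt_eqF// poweRe1.
  apply: gt0_ler_poweR; rewrite ?in_itv/= ?poweR_ge0 ?leey ?lee_fin ?(ltW q0) ?(ltW B0)//.
  exact: ltW.
have avB : (average (later b p rho x t L) (fun z => excess b k z `^ q) <= (B `^ q)%:E)%E.
  apply: le_trans sumB; have := av0 true; have := av0 false.
  by case: b => h1 h2; [rewrite leeDl|rewrite leeDr].
rewrite averageE// in avB.
have lQ : later b p rho x t L `<=` Q by apply: subset_trans RQ; exact: later_prect.
have [_ Eoo] := measure_later_pos b x t L0 r1.
have K0 : 0 < s `^ (- q^-1) by exact: powR_gt0.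
have mE : measurable_fun (later b p rho x t L) (excess b k).
  by apply: measurable_excess => //; exact: measurable_later.
have := chebyshev_powR q0 K0 B0 (measurable_later b rho x t L) Eoo mE
  (fun z _ => excess_ge0 b k z) avB.
rewrite excess_gt ?mulr_ge0 ?(ltW K0) ?(ltW B0)//.
by rewrite -powRrM mulrNN mulVf ?gt_eqF// powRr1// ltW.
Qed.

Lemma integral_of_decay (rho q k D B : R) x (t L : R) : 0 < rho -> rho < 1 -> 0 < q ->
  0 < D -> 0 < B -> 0 < L ->
  (forall b, (\int[mu]_(z in later b p rho x t L) (excess b k z `^ q) <=
    (D * B `^ q)%:E * mu (later b p rho x t L))%E) ->
  (integral_value rho q x t L <= ((2 * D) `^ q^-1 * B)%:E)%E.
Proof.
move=> r0 r1 q0 D0 B0 L0 H.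
apply: le_trans (ereal_inf_lbound _) _; first by exists k.
have av0 b : (0 <= average (later b p rho x t L) (fun z => excess b k z `^ q))%E.
  rewrite mule_ge0 ?lee_fin ?invr_ge0 ?fine_ge0 ?measure_ge0//.
  by apply: integral_ge0 => z _; exact: poweR_ge0.
have av b : (average (later b p rho x t L) (fun z => excess b k z `^ q) <= (D * B `^ q)%:E)%E.
  by rewrite averageE.
have -> : ((2 * D) `^ q^-1 * B)%:E = ((2 * D * B `^ q)%:E `^ q^-1)%E.
  rewrite poweR_EFin [in RHS]powRM ?mulr_ge0 ?powR_ge0 ?(ltW D0)//.
  by rewrite -powRrM divff ?gt_eqF// powRr1// ltW.
apply: gt0_ler_poweR; rewrite ?in_itv/= ?leey ?andbT ?invr_ge0 ?(ltW q0)//.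
- exact: adde_ge0 (av0 true) (av0 false).
- by rewrite lee_fin !mulr_ge0 ?powR_ge0 ?(ltW D0).
have -> : 2 * D * B `^ q = D * B `^ q + D * B `^ q by ring.
by rewrite EFinD; exact: leeD (av true) (av false).
Qed.

(** [B] runs over the numbers strictly above the supremum of [v]. Strictness makes [B] positive even
    when the supremum is 0 and lets a constant be picked from each infimum. *)
Lemma sup_rectangles_le (v w : 'rV[R]_n -> R -> R -> \bar R) (C : R) : 0 < C ->
  (forall x t L, 0 < L -> prect p x t L `<=` Q -> (0 <= v x t L)%E) ->
  (forall B, 0 < B ->
    (forall x t L, 0 < L -> prect p x t L `<=` Q -> (v x t L < B%:E)%E) ->
    forall x t L, 0 < L -> prect p x t L `<=` Q -> (w x t L <= (C * B)%:E)%E) ->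
  (ereal_sup [set e | exists x t L, [/\ (0 < L)%R, prect p x t L `<=` Q & e = w x t L]] <=
   C%:E * ereal_sup [set e | exists x t L, [/\ (0 < L)%R, prect p x t L `<=` Q & e = v x t L]])%E.
Proof.
move=> C0 v0 vw; apply: ge_ereal_sup => _ [x [t [L [L0 RQ ->]]]].
set S := ereal_sup _.
have vS y r l : 0 < l -> prect p y r l `<=` Q -> (v y r l <= S)%E.
  by move=> l0 RQ'; apply: ereal_sup_ubound; exists y, r, l.
have S0 : (0 <= S)%E by apply: le_trans (vS _ _ _ L0 RQ); exact: v0.
case: S S0 vS => [r| |]// r0 vS; last by rewrite mulry gtr0_sg// mul1e leey.
rewrite lee_fin in r0.
apply/lee_addgt0Pr => e e0; rewrite -EFinM -EFinD.
have -> : C * r + e = C * (r + e / C) by field; rewrite gt_eqF.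
apply: vw => //; first by rewrite ltr_wpDl// divr_gt0.
by move=> y u l l0 RQ'; apply: le_lt_trans (vS _ _ _ l0 RQ') _; rewrite lte_fin ltrDl divr_gt0.
Qed.

Lemma median_value_ge0 (gamma s : R) x (t L : R) : 0 < L -> gamma < 1 -> 0 < s <= 1 ->
  (0 <= median_value gamma s x t L)%E.
Proof.
move=> L0 g1 s01; apply: le_ereal_inf_tmp => _ [k _ <-].
exact: adde_ge0 (max_median_ge0 true k x t L0 g1 s01) (max_median_ge0 false k x t L0 g1 s01).
Qed.

Lemma integral_value_ge0 (rho q : R) x (t L : R) : (0 <= integral_value rho q x t L)%E.
Proof. by apply: le_ereal_inf_tmp => _ [k _ <-]; exact: poweR_ge0. Qed.

End rectangle_values.

(** * Choice of the parameters and equivalence of the two norms *)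

Lemma fine_grid (R : realType) (p gamma rho : R) : 1 < p -> gamma < 1 -> 0 < rho ->
  exists N : nat, 2 * N%:R + 1 + 8 / (1 - gamma) <= rho * N%:R `^ p.
Proof.
move=> p1 g1 r0; have g8 : 0 < 8 / (1 - gamma) by rewrite divr_gt0// subr_gt0.
have p10 : 0 < p - 1 by rewrite subr_gt0.
(* This makes [rho * N ^ (p - 1)] at least [3 + 8 / (1 - gamma)], and multiplying by [N >= 1] gives
   the claim; [p > 1] makes the exponent positive. *)
pose W := (3 + 8 / (1 - gamma)) / rho.
have W0 : 0 < W by rewrite divr_gt0// addr_gt0.
exists (Num.truncn (W `^ (p - 1)^-1)).+1; set N := (Num.truncn _).+1.
have N1 : 1 <= N%:R :> R by rewrite ler1n.
have NW : W <= N%:R `^ (p - 1).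
  rewrite [leLHS](_ : _ = (W `^ (p - 1)^-1) `^ (p - 1)); last first.
    by rewrite -powRrM mulVf ?gt_eqF// powRr1// ltW.
  apply: ge0_ler_powR; rewrite ?nnegrE ?powR_ge0 ?(ltW p10)//.
  exact/ltW/Num.Theory.truncnS_gt.
rewrite -mulr_powRB1//; last exact: lt_trans p1.
rewrite mulrCA; apply: (@le_trans _ _ (N%:R * (3 + 8 / (1 - gamma)))).
  have : 0 <= (N%:R - 1) * (1 + 8 / (1 - gamma)).
    by rewrite mulr_ge0 ?subr_ge0// ltW// addr_gt0.
  by move: (8 / _) => g; lra.
rewrite ler_wpM2l//; move: NW; rewrite /W ler_pdivrMr//.
by rewrite [leRHS]mulrC.
Qed.

Lemma cover_const_ge0 (R : realType) (n : nat) (p gamma rho : R) (N : nat) :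
  gamma < 1 -> rho < 1 -> 0 <= cover_const (n := n) p gamma rho N.
Proof.
move=> g1 r1; rewrite /cover_const mulr_ge0// divr_ge0 ?subr_ge0 ?(ltW r1)//.
by rewrite divr_ge0// subr_ge0 ltW.
Qed.

Lemma small_fraction (R : realType) (s A Y : R) : 0 < s <= 1 -> 0 <= A -> 0 < Y ->
  exists s', [/\ 0 < s', 2 * s' * A < s & s' * Y < 1].
Proof.
move=> /andP[s0 s1] A0 Y0; have den_gt0 : 0 < 2 * A + 1 + 2 * Y by lra.
exists (s / (2 * A + 1 + 2 * Y)); set s' := s / _; have s'0 : 0 < s' by exact: divr_gt0.
have s'E : s' * (2 * A + 1 + 2 * Y) = s by rewrite divfK// gt_eqF.
have h1 : 0 < s' * Y by exact: mulr_gt0.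
have h2 : 0 <= s' * A by rewrite mulr_ge0// ltW.
by move: (s') s'0 s'E h1 h2 => r *; split => //; lra.
Qed.

Theorem corollary6p8 (R : realType) (n : nat) (p gamma : R) :
  (1 <= n)%N -> 1 < p -> 0 < gamma < 1 ->
  exists s0 : R, 0 < s0 <= 1 /\
  forall q rho s : R, 0 < q -> 0 < rho < 1 -> 0 < s <= s0 ->
  exists c1 c2 : R, [/\ 0 < c1, 0 < c2 &
  forall (Omega : set 'rV[R]_n) (T : R), is_domain Omega -> 0 < T ->
  forall f : spacetime R n -> \bar R,
  measurable_fun (cylinder Omega T) f ->
  ((c1%:E * PBMO_median p gamma s (cylinder Omega T) f
      <= PBMO p rho q (cylinder Omega T) f)%E /\
   (PBMO p rho q (cylinder Omega T) f
      <= c2%:E * PBMO_median p gamma s (cylinder Omega T) f)%E)].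
Proof.
move=> _ p1 /andP[g0 g1].
pose m := (Num.truncn (4 / (1 - gamma))).+2.
have m_large : 4 <= (1 - gamma) * m%:R.
  rewrite -ler_pdivrMl ?subr_gt0// mulrC ltW// (lt_trans (Num.Theory.truncnS_gt _))//.
  by rewrite ltr_nat.
(* The three demands on the smallness of [s]: [X1] for links between parent and child, [X2] for
   halving in the decay step, [X3] for links along chains. *)
pose X1 : R := m%:R ^+ n * m%:R `^ p + 1.
pose X2 : R := 16 * (1 + 4 / top_ratio gamma).
pose X3 : R := 2 ^+ n.+2.
have X1_ge1 : 1 <= X1 by rewrite lerDr mulr_ge0 ?powR_ge0 ?exprn_ge0.
have X2_gt0 : 0 < X2.
  by rewrite mulr_gt0// addr_gt0// divr_gt0// divr_gt0// subr_gt0.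
have X3_gt0 : 0 < X3 by rewrite exprn_gt0.
have sum_gt0 : 0 < X1 + X2 + X3 by lra.
exists (X1 + X2 + X3)^-1; split; first by rewrite invr_gt0 sum_gt0 invf_le1//; lra.
move=> q rho s q0 /andP[r0 r1] /andP[s0 sX].
have sX' : s * (X1 + X2 + X3) <= 1 by rewrite -ler_pdivlMr// mul1r.
have sX1 : s * X1 < 1.
  by have : 0 < s * (X2 + X3) by [rewrite mulr_gt0// addr_gt0]; lra.
have sX2 : s * X2 <= 1.
  by have : 0 < s * (X1 + X3) by [rewrite mulr_gt0//; lra]; lra.
have sX3 : s * X3 < 1.
  by have : 0 < s * (X1 + X2) by [rewrite mulr_gt0//; lra]; lra.
have s1 : s <= 1.
  by have : 0 <= s * (X1 - 1) + s * (X2 + X3) by [rewrite addr_ge0// mulr_ge0//; lra]; lra.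
have s01 : 0 < s <= 1 by rewrite s0.
(* [N1] serves the passage from lag [gamma] to [rho], [N2] the one from [rho] to [gamma]. *)
have [N1 N1_large] := fine_grid p1 g1 r0.
have [N2 N2_large] := fine_grid p1 r1 g0.
have A1_ge0 := cover_const_ge0 n p N1 g1 r1.
have A2_ge0 := cover_const_ge0 n p N2 r1 g1.
set A1 := cover_const _ _ _ _ in A1_ge0; set A2 := cover_const _ _ _ _ in A2_ge0.
have a_ge0 (N : nat) : 0 <= 2 * N%:R `^ p :> R by rewrite mulr_ge0 ?powR_ge0.
have [D D0 layer] := layer_cake (@lebesgue_st R n) q0 (a_ge0 N1) A1_ge0.
(* The change of lag multiplies exceptional fractions by [2 * A2], so Chebyshev's inequality is used
   with a fraction [s'] small enough to end strictly below [s]. *)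
have [s' [s'0 s'A2 s'X3]] := small_fraction s01 A2_ge0 X3_gt0.
pose K := s' `^ (- q^-1); have K0 : 0 < K by exact: powR_gt0.
have b0 : 0 < 2 * N2%:R `^ p + 1 :> R by exact: ltr_wpDl (a_ge0 N2) ltr01.
(* In the first constant, 2 counts the two medians, the bracket is the loss in [lag_change], and [K]
   comes from Chebyshev's inequality. *)
exists (2 * (2 * N2%:R `^ p + 1) * K)^-1, ((2 * D) `^ q^-1).
have C0 : 0 < 2 * (2 * N2%:R `^ p + 1) * K by rewrite !mulr_gt0.
split; [by rewrite invr_gt0|by rewrite powR_gt0// mulr_gt0|].
move=> Omega T [_ oO _] T0 f mf; set Q := cylinder Omega T.
have mQ : measurable Q by exact: measurable_cylinder.
split.
  set C := 2 * _ * K in C0 *.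
  have -> : PBMO p rho q Q f = (C^-1%:E * (C%:E * PBMO p rho q Q f))%E.
    by rewrite muleA -EFinM mulVf ?gt_eqF// mul1e.
  rewrite lee_wpmul2l ?lee_fin ?invr_ge0 ?(ltW C0)//.
  apply: (sup_rectangles_le (v := integral_value f p rho q) (w := median_value f p gamma s)) => //.
    by move=> x t L _ _; exact: integral_value_ge0.
  move=> B B0 /(control_of_integral mQ mf r0 r1 q0 s'0 B0)[c ctl] x t L L0 RQ.
  have KB0 : 0 <= K * B by rewrite mulr_ge0 ?ltW.
  rewrite (_ : C * B = 2 * ((2 * N2%:R `^ p + 1) * (K * B))); last by rewrite /C; ring.
  apply: (median_of_control (k := c x t (L / N2%:R))) => //.
    by rewrite mulr_ge0// ltW.
  move=> b; have [E0 Eoo] := measure_later_pos p b x t L0 g1.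
  apply: le_lt_trans (lag_change mQ mf p1 r0 r1 KB0 (ltW s'0) ctl s'X3 g0 g1 N2_large b L0 RQ) _.
  by rewrite lte_pmul2r// ge0_fin_numE// ltW.
apply: (sup_rectangles_le (v := median_value f p gamma s) (w := integral_value f p rho q)) => //.
- by rewrite powR_gt0// mulr_gt0.
- by move=> x t L L0 _; exact: median_value_ge0.
move=> B B0 /(control_of_median mQ mf g0 g1 s01 B0)[c ctl] x t L L0 RQ.
apply: (integral_of_decay (k := c x t (L / N1%:R))) => // b.
have [E0 Eoo] := measure_later_pos p b x t L0 r1.
have lQ : later b p rho x t L `<=` Q by apply: subset_trans RQ; exact: later_prect.
apply: layer => //.
- exact: measurable_later.
- by apply: (measurable_excess mQ mf) => //; exact: measurable_later.
- by move=> z _; exact: excess_ge0.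
- move=> j; rewrite excess_gt; last by rewrite mulr_ge0 ?(ltW B0)// addr_ge0.
  apply: (lag_decay mQ mf p1 g0 g1 (ltW B0) (ltW s0) ctl sX3 r0 r1 N1_large b j (m := m)) => //.
  by rewrite mulrC.
Qed.
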